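(* With $(V,\ell)$, $B_{h_1,\ell}$ and $\psi$ as in the context, let $\Psi:B_{h_1,\ell}\to MC(V,\ell)$, $\Psi(v)=\psi(v)(1)$. Then $\Psi$ is smooth, and there exists an open subset $0\in U\subset B_{h_1,\ell}$ such that $\Psi:U\subset\ker(\ell_1|_{V_0})\to MC(V,\ell)\subset\mathbb{R}^n$ is an embedding.
   Context: $(V,\ell)$ is an $N$-strict $L_\infty$-algebra (graded symmetric degree-1 multilinear maps $\ell_k$, $\ell_0=0$, $L_\infty$ Jacobi identities, $\ell_k=0$ for $k\geq N$) with finite-dimensional components, $V_0=\mathbb{R}^n$, and $H^1(V,\ell)=\ker(\ell_1|_{V_1})/\operatorname{im}(\ell_1|_{V_0})=0$; $h_1:V_1\to V_0$, $h_2:V_2\to V_1$ are linear with $\ell_1h_1+h_2\ell_1=\mathrm{id}_{V_1}$. Norms fixed on $V_0,V_1$; $\|h_1\|,\|\ell_i\|$ ($\ell_i:V_0^{\times i}\to V_1$) operator norms; $\alpha_\ell=\sum_{i=1}^N\|\ell_i\|/i!$; $B_{h_1,\ell}=\{v\in\ker(\ell_1|_{V_0}):\|v\|<\frac1{12\|h_1\|\alpha_\ell}\}$. For $v\in B_{h_1,\ell}$: $v_0=0$, $v_1=v$, $v_{k+1}=-h_1\big(\sum_{i=2}^{k+1}\sum_{r_1+\cdots+r_i=k+1,\,r_j\geq1}\frac{(k+1)!}{r_1!\cdots r_i!}\frac1{i!}\ell_i(v_{r_1},\ldots,v_{r_i})\big)$, and $\psi(v)(t)=\sum_{k\geq0}\frac{v_k}{k!}t^k$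 for $t\in[0,2)$. $MC(V,\ell)$ is the zero set of $MC(v)=\sum_{k\geq1}\frac1{k!}\ell_k(v,\ldots,v)$. *)

(* Defs.v *)
From HB Require Import structures.
From mathcomp Require Import all_boot all_order all_algebra.
From mathcomp Require Import all_classical all_reals all_analysis.
Set Implicit Arguments. Unset Strict Implicit. Unset Printing Implicit Defensive.
Import Order.TTheory GRing.Theory Num.Theory.
Import numFieldNormedType.Exports.
Local Open Scope classical_set_scope.
Local Open Scope ring_scope.

(* The L_infinity algebra is described by its components in degrees 0,1,2: V0 = 'rV[R]_n, V1 = 'rV[R]_m1, V2 = 'rV[R]_m2.
   l  s     = ell_k (s_1,...,s_k) : V1      for s : seq V0 of size k
   l' y s   = ell_{k+1} (y, s_1,...,s_k) : V2  for y : V1, s : seq V0.   *)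

Section Defs.
Variable R : realType.
Variables n m1 m2 : nat.
Local Notation V0 := 'rV[R]_n.
Local Notation V1 := 'rV[R]_m1.
Local Notation V2 := 'rV[R]_m2.

Definition is_norm (m : nat) (nrm : 'rV[R]_m -> R) : Prop :=
  (forall x, 0 <= nrm x) /\ (forall x, nrm x = 0 -> x = 0) /\
  (forall (a : R) x, nrm (a *: x) = `|a| * nrm x) /\
  (forall x y, nrm (x + y) <= nrm x + nrm y).

Definition multilin0 (m : nat) (l : seq V0 -> 'rV[R]_m) : Prop :=
  forall (s1 s2 : seq V0) (a : R) (x y : V0),
    l (s1 ++ (a *: x + y) :: s2) = a *: l (s1 ++ x :: s2) + l (s1 ++ y :: s2).

Definition symmetric0 (m : nat) (l : seq V0 -> 'rV[R]_m) : Prop :=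
  forall s t : seq V0, perm_eq s t -> l s = l t.

(* The L_infinity data restricted to degrees 0, 1, 2, with all the
   L_infinity Jacobi identities whose arguments lie in V0 (these are the only
   Jacobi identities involving only these components), N-strictness. *)
Definition Linf_data (N : nat) (l : seq V0 -> V1) (l' : V1 -> seq V0 -> V2) : Prop :=
  l [::] = 0 /\
  multilin0 l /\ symmetric0 l /\
  (forall y, multilin0 (l' y)) /\ (forall y, symmetric0 (l' y)) /\
  (forall (a : R) y z s, l' (a *: y + z) s = a *: l' y s + l' z s) /\
  (forall k (x : 'I_k -> V0),
     \sum_(S : {set 'I_k} | S != finset.set0)
        l' (l [seq x i | i in S]) [seq x i | i in finset.setC S] = 0) /\
  (forall s, (N <= size s)%N -> l s = 0) /\
  (forall y s, (N <= (size s).+1)%N -> l' y s = 0).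

Definition kerl1 (l : seq V0 -> V1) (x : V0) : bool := l [:: x] == 0.

Definition H1_zero (l : seq V0 -> V1) (l' : V1 -> seq V0 -> V2) : Prop :=
  forall y : V1, l' y [::] = 0 -> exists x : V0, l [:: x] = y.

Definition MC (N : nat) (l : seq V0 -> V1) (x : V0) : V1 :=
  \sum_(1 <= k < N.+1) (k`!%:R)^-1 *: l (nseq k x).

Definition opnorm_h1 (nrm0 : V0 -> R) (nrm1 : V1 -> R) (h1 : V1 -> V0) : R :=
  sup [set nrm0 (h1 y) | y in [set y | nrm1 y <= 1]].

Definition opnorm_l (nrm0 : V0 -> R) (nrm1 : V1 -> R) (l : seq V0 -> V1) (i : nat) : R :=
  sup [set nrm1 (l s) | s in [set s : seq V0 | size s = i /\ (forall x, x \in s -> nrm0 x <= 1)]].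

Definition alpha_l (nrm0 : V0 -> R) (nrm1 : V1 -> R) (N : nat) (l : seq V0 -> V1) : R :=
  \sum_(1 <= i < N.+1) opnorm_l nrm0 nrm1 l i / i`!%:R.

(* B_{h1,ell} = { v in ker ell_1|V0 : ||v|| < 1/(12 ||h1|| alpha) }, with
   1/0 read as +infinity *)
Definition Bset (nrm0 : V0 -> R) (nrm1 : V1 -> R) (N : nat) (l : seq V0 -> V1)
  (h1 : V1 -> V0) : set V0 :=
  [set v | kerl1 l v /\
           nrm0 v * (12 * opnorm_h1 nrm0 nrm1 h1 * alpha_l nrm0 nrm1 N l) < 1].

(* the recursive sequence v_k:  given prev = [:: v_0; ...; v_k] (k1 = k+1
   entries) compute v_{k+1} *)
Definition vstep (l : seq V0 -> V1) (h1 : V1 -> V0) (prev : seq V0) : V0 :=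
  let k1 := size prev in
  - h1 (\sum_(2 <= i < k1.+1)
          \sum_(r : {ffun 'I_i -> 'I_k1.+1} |
                  ((\sum_(j < i) (r j : nat))%N == k1) && [forall j, (0 < r j)%N])
            ((k1`!%:R / (\prod_(j < i) ((r j)`!)%:R)) / i`!%:R) *:
              l [seq nth 0 prev (r j) | j <- enum 'I_i]).

Fixpoint vlist (l : seq V0 -> V1) (h1 : V1 -> V0) (v : V0) (k : nat) : seq V0 :=
  match k with
  | 0 => [:: 0]
  | 1 => [:: 0; v]
  | k'.+1 => let p := vlist l h1 v k' in rcons p (vstep l h1 p)
  end.

Definition vseq (l : seq V0 -> V1) (h1 : V1 -> V0) (v : V0) (k : nat) : V0 :=
  nth 0 (vlist l h1 v k) k.

Definition psi (l : seq V0 -> V1) (h1 : V1 -> V0) (v : V0) (t : R) : V0 :=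
  limn (fun M => \sum_(k < M) ((t ^+ k) / k`!%:R) *: vseq l h1 v k).

Definition Psi (l : seq V0 -> V1) (h1 : V1 -> V0) (v : V0) : V0 := psi l h1 v 1.

End Defs.

Fixpoint iterD (R : realType) (p q : nat) (us : seq 'rV[R]_p)
  (f : 'rV[R]_p -> 'rV[R]_q) : 'rV[R]_p -> 'rV[R]_q :=
  match us with
  | [::] => f
  | u :: us' => fun x => derive (iterD us' f) x u
  end.

(* f is smooth on A, A an (relatively) open subset of the linear subspace
   K (given by a boolean predicate): all iterated directional derivatives
   along directions in K exist at every point of A and are continuous on A. *)
Definition smooth_along (R : realType) (p q : nat) (K : pred 'rV[R]_p)
  (A : set 'rV[R]_p) (f : 'rV[R]_p -> 'rV[R]_q) : Prop :=
  forall us : seq 'rV[R]_p, all K us ->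
    (forall x u, A x -> K u -> derivable (iterD us f) x u) /\
    {within A, continuous (iterD us f)}.

Definition open_in_sub (R : realType) (p : nat) (K : pred 'rV[R]_p)
  (U : set 'rV[R]_p) : Prop :=
  exists O : set 'rV[R]_p, open O /\ U = O `&` [set x | K x].

(* f : U (subset of K) -> R^q is a smooth embedding: smooth, immersion
   (injective differential on K), injective and a homeomorphism onto its
   image (continuous inverse). *)
Definition embedding_on (R : realType) (p q : nat) (K : pred 'rV[R]_p)
  (U : set 'rV[R]_p) (f : 'rV[R]_p -> 'rV[R]_q) : Prop :=
  [/\ smooth_along K U f,
      (forall x u, U x -> K u -> derive f x u = 0 -> u = 0),
      (forall x y, U x -> U y -> f x = f y -> x = y) &
      (forall x e, U x -> 0 < e -> exists2 d, 0 < d &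
          forall y, U y -> `|f y - f x| < d -> `|y - x| < e)].

(* Main.v *)
Require Import Defs.
From HB Require Import structures.
From mathcomp Require Import all_boot all_order all_algebra.
From mathcomp Require Import all_classical all_reals all_analysis.
From mathcomp Require Import ring lra.

(* [Psi] inverts the polynomial map [Phi x = x + h1 (F x)], where
   [F x = \sum_(i >= 2) l_i (x, ..., x) / i!]: the recursion for [v_k] is the
   equation [psi(t) = t v - h1 (F (psi(t)))] read off coefficientwise.
   Convergence and the smallness of [Psi v] come from the majorant
   [g >= 2 |v| + |h1| \sum_(i >= 2) (|l_i| / i!) g ^ i] with
   [g = 1 / (4 |h1| alpha)].  This needs [g <= 1], that is [|h1| alpha >= 1],
   which holds as soon as [l' _ [::]] has a nonzero kernel, since there
   [l_1 \o h1 = id]; otherwise the Jacobi identities make every bracket vanish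
   and [Psi = id].

   No smallness of [h2] or [l'] is available, so [MC (Psi v) = 0] is shown
   formally: the Taylor coefficients of [MC (psi(t))] vanish one after the other
   by the Jacobi identity and [l_1 h1 + h2 l'_1 = id].

   Writing [Phi y - Phi x = (y - x) *m Q x y] with [Q] polynomial and invertible
   on the range of [Psi], [Psi] is Lipschitz, its differential is
   [Q (Psi v) (Psi v) ^-1], and the algebra generated by the coordinates of [Psi]
   and by inverses of nonvanishing functions is stable under directional
   derivatives.  The whole of [B] can serve as [U]. *)

Set Implicit Arguments. Unset Strict Implicit. Unset Printing Implicit Defensive.
Import Order.TTheory GRing.Theory Num.Theory.
Import numFieldNormedType.Exports.
Local Open Scope classical_set_scope.
Local Open Scope ring_scope.

(** * Norms on row vectors *)

Section Norms.
Variable R : realType.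

Lemma mx_coord_le m n (x : 'M[R]_(m, n)) i j : `|x i j| <= `|x|.
Proof.
rewrite [leRHS]/Num.Def.normr /= mx_normrE.
exact: (le_bigmax _ (fun ij : 'I_m * 'I_n => `|x ij.1 ij.2|) (i, j)).
Qed.

Lemma mx_norm_bound m n (x : 'M[R]_(m, n)) e :
  0 <= e -> (forall i j, `|x i j| <= e) -> `|x| <= e.
Proof.
move=> e0 xe; rewrite [leLHS]/Num.Def.normr /= mx_normrE.
by apply: bigmax_le => // -[i j] _; exact: xe.
Qed.

Section OneNorm.
Variables (m : nat) (nrm : 'rV[R]_m -> R).
Hypothesis nrmP : is_norm nrm.

Lemma is_norm_ge0 x : 0 <= nrm x. Proof. by case: nrmP => H _; exact: H. Qed.
Lemma is_norm_eq0 x : nrm x = 0 -> x = 0. Proof. by case: nrmP => _ [H _]; exact: H. Qed.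
Lemma is_normZ a x : nrm (a *: x) = `|a| * nrm x.
Proof. by case: nrmP => _ [_ [H _]]; exact: H. Qed.
Lemma is_norm_leD x y : nrm (x + y) <= nrm x + nrm y.
Proof. by case: nrmP => _ [_ [_ H]]; exact: H. Qed.

Lemma is_norm0 : nrm 0 = 0.
Proof. by rewrite -(scale0r 0) is_normZ normr0 mul0r. Qed.

Lemma is_normN x : nrm (- x) = nrm x.
Proof. by rewrite -scaleN1r is_normZ normrN1 mul1r. Qed.

Lemma is_norm_gt0 x : x != 0 -> 0 < nrm x.
Proof.
by move=> x0; rewrite lt_neqAle is_norm_ge0 andbT eq_sym; apply: contra_neq x0 => /is_norm_eq0.
Qed.

Lemma is_norm_sum (I : Type) (r : seq I) (P : pred I) (F : I -> 'rV[R]_m) :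
  nrm (\sum_(i <- r | P i) F i) <= \sum_(i <- r | P i) nrm (F i).
Proof.
elim/big_ind2 : _ => [|x a y b xa yb|//]; first by rewrite is_norm0.
exact: (le_trans (is_norm_leD _ _) (lerD xa yb)).
Qed.

Lemma is_norm_le_mx : exists2 C, 0 < C & forall x, nrm x <= C * `|x|.
Proof.
exists (1 + \sum_i nrm (delta_mx 0 i)).
  by rewrite ltr_pwDl// sumr_ge0// => i _; exact: is_norm_ge0.
move=> x; rewrite {1}(row_sum_delta x) (le_trans (is_norm_sum _ _ _))//.
rewrite mulrDl mul1r mulr_suml -[leLHS]add0r lerD// ler_sum// => i _.
by rewrite is_normZ mulrC ler_wpM2l ?is_norm_ge0// mx_coord_le.
Qed.

Lemma is_norm_continuous : continuous nrm.
Proof.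
have [C C0 nC] := is_norm_le_mx.
move=> x; apply/(@cvgrPdist_le _ _ _ (nbhs x) (nbhs_filter x)) => e e0.
apply/(@nbhs_normP _ _ x); exists (e / C); first by rewrite /= divr_gt0.
move=> y /ltW xy /=.
have H a b : nrm a - nrm b <= nrm (a - b).
  by rewrite lerBlDr -{1}(subrK b a) is_norm_leD.
have E : nrm (x - y) <= e.
  rewrite (le_trans (nC _))// mulrC -ler_pdivlMr//.
rewrite ler_norml; apply/andP; split; last exact: le_trans (H _ _) E.
by rewrite lerNl opprB (le_trans (H _ _))// -is_normN opprB.
Qed.

(* The norm attains a positive minimum on the compact sup-norm sphere. *)
Lemma is_norm_ge_mx : exists2 C, 0 < C & forall x, `|x| <= C * nrm x.
Proof.
have [nt|/forallNP all0] := pselect (exists x : 'rV[R]_m, x != 0); last first.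
  exists 1 => // x; have /negP/negPn/eqP -> := all0 x.
  by rewrite normr0 mul1r is_norm_ge0.
have normx (x : 'rV[R]_m) : x != 0 -> `| `|x|^-1 *: x| = 1.
  by move=> x0; rewrite normrZ normfV normr_id mulVf// normr_eq0.
pose S := [set x : 'rV[R]_m | `|x| = 1].
have S0 : S !=set0 by case: nt => x x0; exists (`|x|^-1 *: x); exact: normx.
have cS : compact S.
  apply: bounded_closed_compact.
    by exists 1; split => // t t1 x /= ->; exact: ltW.
  have -> : S = (fun x : 'rV[R]_m => `|x|) @^-1` [set 1] by [].
  by apply: preimage_closed => [x _|]; [exact: norm_continuous|exact: closed_eq].
have [|c cS1 cmin] := EVT_min_rV (f := nrm) S0 cS.
  exact/continuous_subspaceT/is_norm_continuous.
rewrite inE /S/= in cS1.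
have c0 : 0 < nrm c.
  by apply: is_norm_gt0; apply/eqP => c0; move: cS1; rewrite c0 normr0 => /esym/eqP; rewrite oner_eq0.
exists (nrm c)^-1; first by rewrite invr_gt0.
move=> x; have [->|x0] := eqVneq x 0; first by rewrite normr0 is_norm0 mulr0.
have := cmin (`|x|^-1 *: x); rewrite inE => /(_ (normx _ x0)).
rewrite is_normZ normfV normr_id ler_pdivlMl ?normr_gt0// => H.
by rewrite ler_pdivlMl// mulrC.
Qed.

End OneNorm.

Lemma linear_bounded (m p : nat) (nrm : 'rV[R]_m -> R) (nrm' : 'rV[R]_p -> R)
    (f : {linear 'rV[R]_m -> 'rV[R]_p}) : is_norm nrm -> is_norm nrm' ->
  exists2 C, 0 <= C & forall x, nrm' (f x) <= C * nrm x.
Proof.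
move=> nP nP'; have [D D0 xD] := is_norm_ge_mx nP.
pose E := \sum_i nrm' (f (delta_mx 0 i)).
have E0 : 0 <= E by rewrite sumr_ge0// => i _; exact: is_norm_ge0.
exists (D * E); first by rewrite mulr_ge0// ltW.
move=> x; rewrite {1}(row_sum_delta x) linear_sum (le_trans (is_norm_sum nP' _ _ _))//.
rewrite mulrAC /E mulr_sumr ler_sum// => i _.
rewrite linearZ/= (is_normZ nP') ler_wpM2r ?(is_norm_ge0 nP')//.
exact: le_trans (mx_coord_le _ _ _) (xD x).
Qed.

(** [sup] dominates its set only once an upper bound is known, and [linear_bounded] provides one;
    normalizing [y] then gives the inequality. *)
Lemma opnorm_h1P (n m1 : nat) (nrm0 : 'rV[R]_n -> R) (nrm1 : 'rV[R]_m1 -> R)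
    (h1 : {linear 'rV[R]_m1 -> 'rV[R]_n}) : is_norm nrm0 -> is_norm nrm1 ->
  0 <= opnorm_h1 nrm0 nrm1 h1 /\
  forall y, nrm0 (h1 y) <= opnorm_h1 nrm0 nrm1 h1 * nrm1 y.
Proof.
move=> n0P n1P; have [C C0 hC] := linear_bounded h1 n1P n0P.
set A := [set nrm0 (h1 y) | y in [set y | nrm1 y <= 1]].
have ubA : has_ubound A.
  by exists C => _ [y /= y1 <-]; rewrite (le_trans (hC y))// ler_piMr.
have A0 : A 0 by exists 0; rewrite /= ?(is_norm0 n1P)// linear0 (is_norm0 n0P).
split; first exact: ub_le_sup A0.
move=> y; have [->|y0] := eqVneq y 0.
  by rewrite linear0 (is_norm0 n0P) (is_norm0 n1P) mulr0.
have ny := is_norm_gt0 n1P y0.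
have : nrm0 (h1 ((nrm1 y)^-1 *: y)) <= sup A.
  apply: ub_le_sup => //; exists ((nrm1 y)^-1 *: y) => //=.
  by rewrite (is_normZ n1P) ger0_norm ?invr_ge0 ?(ltW ny)// mulVf// lt0r_neq0.
rewrite linearZ/= (is_normZ n0P) ger0_norm ?invr_ge0 ?(ltW ny)//.
by rewrite ler_pdivrMl// mulrC.
Qed.

End Norms.

(** * Multilinear maps on sequences *)

Section FfunCons.
Variables (J : finType) (i : nat).

(** Lets a sum over index tuples be peeled one slot at a time, in step with the head of the argument
    list of a multilinear map. *)
Definition ffun_cons (a : J) (r : {ffun 'I_i -> J}) : {ffun 'I_i.+1 -> J} :=
  [ffun j => if unlift ord0 j is Some j' then r j' else a].

Lemma ffun_cons0 a r : ffun_cons a r ord0 = a.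
Proof. by rewrite ffunE unlift_none. Qed.

Lemma ffun_consS a r j : ffun_cons a r (lift ord0 j) = r j.
Proof. by rewrite ffunE liftK. Qed.

Lemma sum_ffunS (V : nmodType) (G : {ffun 'I_i.+1 -> J} -> V) :
  \sum_r G r = \sum_a \sum_r G (ffun_cons a r).
Proof.
rewrite pair_big /= (reindex (fun p => ffun_cons p.1 p.2)) //=.
apply: onW_bij; exists (fun r : {ffun 'I_i.+1 -> J} =>
  (r ord0, [ffun j : 'I_i => r (lift ord0 j)])).
  move=> [a r] /=; rewrite ffun_cons0; congr (_, _).
  by apply/ffunP => j; rewrite ffunE ffun_consS.
move=> r; apply/ffunP => j; rewrite ffunE /=.
by case: unliftP => [j' ->|->//]; rewrite ffunE.
Qed.

End FfunCons.

Section Multilinear.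
Variables (R : realType) (n m : nat).
Implicit Types (l : seq 'rV[R]_n -> 'rV[R]_m) (s : seq 'rV[R]_n).

Lemma multilin0_zero l s1 s2 : multilin0 l -> l (s1 ++ 0 :: s2) = 0.
Proof.
move=> /(_ s1 s2 1 0 0); rewrite !scale1r addr0 => /eqP.
by rewrite -subr_eq0 opprD addrA subrr sub0r oppr_eq0 => /eqP.
Qed.

Lemma multilin0_mem0 l s : multilin0 l -> 0 \in s -> l s = 0.
Proof. by move=> lP /splitPr[s1 s2]; exact: multilin0_zero. Qed.

Lemma multilin0Z l s1 s2 a x : multilin0 l ->
  l (s1 ++ a *: x :: s2) = a *: l (s1 ++ x :: s2).
Proof. by move=> lP; rewrite -[a *: x]addr0 lP multilin0_zero// addr0. Qed.

Lemma multilin0D l s1 s2 x y : multilin0 l ->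
  l (s1 ++ (x + y) :: s2) = l (s1 ++ x :: s2) + l (s1 ++ y :: s2).
Proof. by move=> lP; rewrite -{1}[x]scale1r lP scale1r. Qed.

Lemma multilin0_sum l s1 s2 (I : Type) (r : seq I) (P : pred I) F :
  multilin0 l -> l (s1 ++ (\sum_(i <- r | P i) F i) :: s2) =
    \sum_(i <- r | P i) l (s1 ++ F i :: s2).
Proof.
move=> lP; apply: (big_morph (fun x => l (s1 ++ x :: s2))).
  by move=> x y; rewrite multilin0D.
exact: multilin0_zero.
Qed.

Lemma multilin0_cons l x : multilin0 l -> multilin0 (fun s => l (x :: s)).
Proof. by move=> lP s1 s2 a y z; have := lP (x :: s1) s2 a y z. Qed.

Lemma multilin0_rV l x s : multilin0 l ->
  l (x :: s) = \sum_b x 0 b *: l (delta_mx 0 b :: s).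
Proof.
move=> lP; rewrite {1}(row_sum_delta x) (multilin0_sum [::])//.
by apply: eq_bigr => b _; rewrite (multilin0Z [::]).
Qed.

Lemma multilin0_scale l (J : Type) (c : J -> R) (f : J -> 'rV[R]_n) (s : seq J) :
  multilin0 l ->
  l [seq c j *: f j | j <- s] = (\prod_(j <- s) c j) *: l [seq f j | j <- s].
Proof.
elim: s l => [|a s IH] l lP /=; first by rewrite big_nil scale1r.
rewrite (multilin0Z [::])// (IH (fun s => l (f a :: s)))/=; last exact: multilin0_cons.
by rewrite big_cons scalerA.
Qed.

(** Full distributivity, by induction on the arity: fixing the first argument leaves a multilinear
    map in the others. *)
Lemma multilin0_expand l (J : finType) i (f : 'I_i -> J -> 'rV[R]_n) :
  multilin0 l ->
  l [seq \sum_a f j a | j <- enum 'I_i] =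
  \sum_(r : {ffun 'I_i -> J}) l [seq f j (r j) | j <- enum 'I_i].
Proof.
elim: i l f => [|i IH] l f lP.
  rewrite (eq_bigr (fun=> l [::])); last first.
    by move=> r _; rewrite (size0nil (s := enum _))// size_enum_ord.
  by rewrite sumr_const card_ffun card_ord expn0 mulr1n (size0nil (s := enum _))// size_enum_ord.
rewrite sum_ffunS enum_ordSl /= (multilin0_sum [::])//; apply: eq_bigr => a _.
rewrite -map_comp (IH (fun s => l (f ord0 a :: s)) (fun j => f (lift ord0 j)) (multilin0_cons _ lP)).
apply: eq_bigr => r _; rewrite ffun_cons0 -map_comp; congr (l (_ :: _)).
by apply: eq_map => j /=; rewrite ffun_consS.
Qed.

Variables (nrm0 : 'rV[R]_n -> R) (nrm1 : 'rV[R]_m -> R).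
Hypotheses (n0P : is_norm nrm0) (n1P : is_norm nrm1).

(** Induction on the arity: expanding the head in the standard basis leaves finitely many maps of
    smaller arity, whose constants are added up. *)
Lemma multilin0_bounded l i : multilin0 l ->
  exists2 C, 0 <= C & forall s, size s = i ->
    nrm1 (l s) <= C * \prod_(x <- s) nrm0 x.
Proof.
have [D D0 xD] := is_norm_ge_mx n0P.
elim: i l => [|i IH] l lP.
  exists (nrm1 (l [::])); first exact: is_norm_ge0.
  by move=> s /size0nil ->; rewrite big_nil mulr1.
have /choice[C CP] : forall b, exists C, 0 <= C /\ forall s, size s = i ->
    nrm1 (l (delta_mx 0 b :: s)) <= C * \prod_(x <- s) nrm0 x.
  by move=> b; have [C ? ?] := IH _ (multilin0_cons (delta_mx 0 b) lP); exists C.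
exists (\sum_b D * C b).
  by rewrite sumr_ge0// => b _; rewrite mulr_ge0 ?(ltW D0)//; case: (CP b).
case=> // x s [si]; rewrite multilin0_rV// (le_trans (is_norm_sum n1P _ _ _))//.
rewrite mulr_suml ler_sum// => b _; rewrite (is_normZ n1P) big_cons.
have [C0 Cs] := CP b.
rewrite (_ : D * C b * _ = (D * nrm0 x) * (C b * \prod_(y <- s) nrm0 y)); last by ring.
rewrite ler_pM ?(is_norm_ge0 n1P)// ?Cs//.
exact: le_trans (mx_coord_le _ _ _) (xD x).
Qed.

Lemma opnorm_lP l : multilin0 l ->
  (forall i, 0 <= opnorm_l nrm0 nrm1 l i) /\
  forall s, nrm1 (l s) <= opnorm_l nrm0 nrm1 l (size s) * \prod_(x <- s) nrm0 x.
Proof.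
move=> lP.
pose A i := [set nrm1 (l s) | s in
  [set s : seq 'rV[R]_n | size s = i /\ (forall x, x \in s -> nrm0 x <= 1)]].
have ubA i : has_ubound (A i).
  have [C C0 CP] := multilin0_bounded i lP.
  exists C => _ [s /= [si s1] <-]; rewrite (le_trans (CP _ si))// ler_piMr//.
  by rewrite big_seq prodr_ile1// => x xs; rewrite (is_norm_ge0 n0P) s1.
split=> [i|s].
  have : A i (nrm1 (l (nseq i 0))).
    by exists (nseq i 0) => //; split; [rewrite size_nseq|move=> x /nseqP[-> _]; rewrite (is_norm0 n0P)].
  by move/(ub_le_sup (ubA i)); apply: le_trans; exact: is_norm_ge0.
(* A zero argument cannot be normalized, but then both sides are zero. *)
have [s0|s0] := boolP (0 \in s).
  rewrite multilin0_mem0// (is_norm0 n1P).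
  by rewrite (big_rem _ s0)/= (is_norm0 n0P) mul0r mulr0.
pose t := [seq (nrm0 x)^-1 *: x | x <- s].
have nz x : x \in s -> 0 < nrm0 x.
  by move=> xs; apply: (is_norm_gt0 n0P); apply: contraNneq s0 => <-.
have : nrm1 (l t) <= sup (A (size s)).
  apply: ub_le_sup => //; exists t => //; split; first by rewrite size_map.
  move=> _ /mapP[x xs ->]; rewrite (is_normZ n0P) ger0_norm ?invr_ge0 ?(ltW (nz _ xs))//.
  by rewrite mulVf// lt0r_neq0// nz.
rewrite /t (multilin0_scale (fun x => (nrm0 x)^-1) id)// map_id (is_normZ n1P).
have p0 : 0 < \prod_(x <- s) nrm0 x by rewrite big_seq prodr_gt0.
rewrite prodfV ger0_norm ?invr_ge0 ?(ltW p0)// => H.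
by rewrite mulrC -ler_pdivrMl.
Qed.

End Multilinear.

(** * Classes of scalar functions closed under polynomial operations *)

Section Subalgebra.
Variables (R : realType) (T : Type).

(** One closure argument serves three classes: functions continuous everywhere, functions continuous
    at a point, and [psi_alg]. *)
Record subalgebra (C : (T -> R) -> Prop) : Prop := {
  subalgC : forall c, C (fun=> c);
  subalgD : forall f g, C f -> C g -> C (fun t => f t + g t);
  subalgM : forall f g, C f -> C g -> C (fun t => f t * g t) }.

Variable C : (T -> R) -> Prop.
Hypothesis CP : subalgebra C.

Lemma subalg_sum (I : Type) (r : seq I) (P : pred I) F :
  (forall i, C (F i)) -> C (fun t => \sum_(i <- r | P i) F i t).
Proof.
move=> FC; elim: r => [|i r IH].
  by under eq_fun do rewrite big_nil; exact: subalgC.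
under eq_fun do rewrite big_cons.
by case: (P i) => //; exact: subalgD.
Qed.

Lemma subalg_prod (I : Type) (r : seq I) (P : pred I) F :
  (forall i, C (F i)) -> C (fun t => \prod_(i <- r | P i) F i t).
Proof.
move=> FC; elim: r => [|i r IH].
  by under eq_fun do rewrite big_nil; exact: subalgC.
under eq_fun do rewrite big_cons.
by case: (P i) => //; exact: subalgM.
Qed.

Lemma subalg_det n (A : T -> 'M[R]_n) :
  (forall i j, C (fun t => A t i j)) -> C (fun t => \det (A t)).
Proof.
move=> AC; apply: subalg_sum => s; apply: subalgM => //; first exact: subalgC.
by apply: subalg_prod => i.
Qed.

Lemma subalg_adj n (A : T -> 'M[R]_n) :
  (forall i j, C (fun t => A t i j)) -> forall i j, C (fun t => (\adj (A t)) i j).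
Proof.
move=> AC i j; under eq_fun do rewrite mxE.
apply: subalgM => //; first exact: subalgC.
by apply: subalg_det => i' j'; under eq_fun do rewrite !mxE.
Qed.

Lemma subalg_multilin0 n m (l : seq 'rV[R]_n -> 'rV[R]_m) (J : Type) (s : seq J)
    (f : J -> T -> 'rV[R]_n) (c : 'I_m) : multilin0 l ->
  (forall j b, C (fun t => f j t 0 b)) ->
  C (fun t => l [seq f j t | j <- s] 0 c).
Proof.
move=> lP fC; elim: s l lP => [|a s IH] l lP /=; first exact: subalgC.
under eq_fun do rewrite multilin0_rV// summxE.
apply: subalg_sum => b; under eq_fun do rewrite mxE.
by apply: subalgM => //; exact: IH (multilin0_cons _ lP).
Qed.

Lemma subalg_linear n m (h : {linear 'rV[R]_n -> 'rV[R]_m}) (f : T -> 'rV[R]_n) :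
  (forall b, C (fun t => f t 0 b)) -> forall c, C (fun t => h (f t) 0 c).
Proof.
move=> fC c.
have E t : h (f t) 0 c = \sum_b f t 0 b * h (delta_mx 0 b) 0 c.
  rewrite {1}(row_sum_delta (f t)) linear_sum summxE.
  by apply: eq_bigr => b _; rewrite linearZ/= mxE.
under eq_fun do rewrite E.
by apply: subalg_sum => b; apply: subalgM => //; exact: subalgC.
Qed.

End Subalgebra.

(** * Regrouping finite sums and comparing coefficients *)

Section WeightedSums.
Variables (V : nmodType) (I : finType) (wt : I -> nat).

Lemma sum_by_weight (D : nat) (G : I -> V) :
  \sum_(k < D) \sum_(r | wt r == k) G r = \sum_(r | (wt r < D)%N) G r.
Proof.
rewrite (exchange_big_dep (fun r => (wt r < D)%N)) /=; last first.
  by move=> k r _ /eqP ->.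
apply: eq_bigr => r rD; by rewrite (big_pred1 (Ordinal rD)).
Qed.

End WeightedSums.

Lemma sum_weight_scale (K : comNzRingType) (V : lmodType K) (I : finType)
    (wt : I -> nat) (t : K) (D : nat) (G : I -> V) :
  (forall r, (wt r < D)%N) ->
  \sum_r t ^+ wt r *: G r = \sum_(c < D) t ^+ c *: \sum_(r | wt r == c) G r.
Proof.
move=> wD.
transitivity (\sum_(c < D) \sum_(r | wt r == c) t ^+ wt r *: G r).
  by rewrite sum_by_weight; apply: eq_bigl => r; rewrite wD.
by apply: eq_bigr => c _; rewrite scaler_sumr; apply: eq_bigr => r /eqP ->.
Qed.

(** Summing over a finite type forces a cap on the indices; this removes the dependence on the cap
    when tuples reaching [D1] contribute nothing. *)
Lemma sum_ffun_widen (V : nmodType) i D1 D2 (G : ('I_i -> nat) -> V) :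
  (D1 <= D2)%N -> (forall r j, (D1 <= r j)%N -> G r = 0) ->
  \sum_(r : {ffun 'I_i -> 'I_D1}) G (fun j => r j) =
  \sum_(r : {ffun 'I_i -> 'I_D2}) G (fun j => r j).
Proof.
move=> D12 G0.
pose h (r : {ffun 'I_i -> 'I_D1}) : {ffun 'I_i -> 'I_D2} := [ffun j => widen_ord D12 (r j)].
have hE r : (fun j => h r j : nat) = (fun j => r j : nat).
  by apply/funext => j; rewrite ffunE.
have hI : injective h.
  move=> r s hrs; apply/ffunP => j; apply/val_inj.
  by have := congr1 (@^~ j) (hE r); rewrite hrs (congr1 (@^~ j) (hE s)).
rewrite [RHS](bigID (fun r : {ffun 'I_i -> 'I_D2} => [forall j, r j < D1]%N))/=.
rewrite [X in _ = _ + X]big1 ?addr0; last first.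
  by move=> r /forallPn[j]; rewrite -leqNgt => rj; exact: (G0 (fun j => r j) j).
rewrite (reindex_omap h (fun r => [pick r1 | h r1 == r]))/=; last first.
  move=> r /forallP rD; case: pickP => [r1 /eqP <-//|].
  move/(_ [ffun j => Ordinal (rD j)]); apply: contraFeq => _.
  by apply/eqP/ffunP => j; rewrite !ffunE; apply/val_inj.
apply: eq_big => [r|r _]; last by congr G.
apply/esym/andP; split; first by apply/forallP => j; rewrite ffunE /=.
by case: pickP => [r1 /eqP/hI ->//|/(_ r)]; rewrite eqxx.
Qed.

Lemma sum_nat_widen (V : nmodType) m a b (F : nat -> V) :
  (a <= b)%N -> (forall i, (m <= i)%N -> (a <= i)%N -> F i = 0) ->
  \sum_(m <= i < a) F i = \sum_(m <= i < b) F i.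
Proof.
move=> ab F0; rewrite (big_nat_widen m a b)// big_mkcond /=.
rewrite !big_nat; apply: eq_bigr => i /andP[mi ib].
by case: ltnP => // ai; rewrite F0.
Qed.

(** Coordinatewise, a nonzero polynomial [p] would have the [size p] distinct roots
    [0, ..., size p - 1]. *)
Lemma vector_poly_eq0 (R : realType) m E (u : nat -> 'rV[R]_m) :
  (forall t : R, \sum_(c < E) t ^+ c *: u c = 0) -> forall c, (c < E)%N -> u c = 0.
Proof.
move=> H c cE; apply/rowP => j; rewrite mxE.
pose p := \poly_(c < E) u c 0 j.
have p0 : p = 0.
  apply: contraTeq isT => pn0.
  pose s : seq R := [seq k%:R | k <- iota 0 (size p)].
  have := max_poly_roots pn0 (rs := s).
  rewrite size_map size_iota ltnn; apply.
    apply/allP => x _; rewrite rootE horner_poly.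
    have /rowP/(_ j) := H x; rewrite summxE mxE => e; apply/eqP; rewrite -[RHS]e.
    by apply: eq_bigr => k _; rewrite mxE mulrC.
  rewrite map_inj_uniq ?iota_uniq// => x y /eqP.
  by rewrite eqr_nat => /eqP.
by have := coef_poly E (fun c => u c 0 j) c; rewrite -/p p0 coef0 cE.
Qed.

(** Cauchy product reindexing [c = a + p]. *)
Lemma sum_triangle (V : nmodType) C (H : nat -> nat -> V) :
  \sum_(c < C) \sum_(a < c.+1) H a (c - a)%N =
  \sum_(a < C) \sum_(p < C - a) H a p.
Proof.
transitivity (\sum_(c < C) \sum_(a < C | (a <= c)%N) H a (c - a)%N).
  apply: eq_bigr => c _.
  by rewrite (big_ord_widen C (fun a => H a (c - a)%N)) ?ltn_ord.
rewrite (exchange_big_dep predT)//=; apply: eq_bigr => a _.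
rewrite -(big_mkord (fun c => a <= c)%N (fun c => H a (c - a)%N)).
rewrite -(big_nat_widenl a 0 C predT (fun c => H a (c - a)%N))//.
rewrite -{1}[a : nat]add0n big_addn big_mkord.
by apply: eq_bigr => p _; rewrite addnK.
Qed.

(** * The coefficients of psi *)

Section Compositions.
Variables (R : realType) (n : nat).
Implicit Types (w : nat -> 'rV[R]_n).

Definition wtsum i (r : 'I_i -> nat) : nat := \sum_(j < i) r j.

Definition entries w i (r : 'I_i -> nat) : seq 'rV[R]_n := [seq w (r j) | j <- enum 'I_i].

Lemma size_entries w i (r : 'I_i -> nat) : size (entries w r) = i.
Proof. by rewrite size_map size_enum_ord. Qed.

(** The coefficient of [t ^+ k] in [l] evaluated at [i] copies of [\sum_(k < D) t ^+ k *: w k]; see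
    [multilin0_nseq_homog]. *)
Definition homog m (l : seq 'rV[R]_n -> 'rV[R]_m) w i D k : 'rV[R]_m :=
  \sum_(r : {ffun 'I_i -> 'I_D} | wtsum (fun j => r j) == k) l (entries w (fun j => r j)).

Lemma wtsum_other i (r : 'I_i -> nat) j j' : j != j' -> (wtsum r <= r j)%N -> r j' = 0%N.
Proof.
move=> jj'; rewrite /wtsum (bigD1 j)//= (bigD1 j')/= 1?eq_sym// -{2}[r j]addn0 leq_add2l.
by rewrite leqn0 addn_eq0 => /andP[/eqP].
Qed.

Lemma wtsum_lt i (r : 'I_i -> nat) : (wtsum r < i)%N -> exists j, r j = 0%N.
Proof.
move=> H; have [/existsP[j /eqP rj]|] := boolP [exists j, r j == 0%N]; first by exists j.
rewrite negb_exists => /forallP rn; move: H; rewrite ltnNge => /negP[].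
rewrite -{1}[i]card_ord -sum1_card /wtsum leq_sum// => j _.
by rewrite lt0n rn.
Qed.

Lemma wtsum_bound i D (r : {ffun 'I_i -> 'I_D}) : (wtsum (fun j => r j) <= i * D)%N.
Proof.
rewrite /wtsum (leq_trans (n := \sum_(j < i) D))//.
  by apply: leq_sum => j _; exact/ltnW/ltn_ord.
by rewrite sum_nat_const card_ord.
Qed.

Section OneMap.
Variables (m : nat) (l : seq 'rV[R]_n -> 'rV[R]_m) (w : nat -> 'rV[R]_n).
Hypotheses (lP : multilin0 l) (w0 : w 0%N = 0).

Lemma multilin0_entries0 i (r : 'I_i -> nat) j : r j = 0%N -> l (entries w r) = 0.
Proof.
move=> rj; apply: multilin0_mem0 => //.
by apply/mapP; exists j; rewrite ?mem_enum// rj.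
Qed.

(** A weight smaller than the number of parts forces a zero part, and [w 0 = 0] kills that
    bracket. *)
Lemma homog_lt i D k : (k < i)%N -> homog l w i D k = 0.
Proof.
move=> ki; apply: big1 => r /eqP rk.
have [|j rj] := @wtsum_lt i (fun j => r j); first by rewrite rk.
exact: (@multilin0_entries0 i (fun j => r j) j).
Qed.

(** With at least two parts, a part reaching [D1 >= k] uses up the whole weight, so another part is
    zero and the bracket vanishes. This is why [k = D1] is still allowed, which the recursion for
    [vcoef] exploits. *)
Lemma homog_widen i D1 D2 k : (1 < i)%N -> (k <= D1 <= D2)%N ->
  homog l w i D1 k = homog l w i D2 k.
Proof.
move=> i1 /andP[kD D12]; rewrite /homog big_mkcond [RHS]big_mkcond /=.
apply: (sum_ffun_widen (G := fun r => if wtsum r == k then l (entries w r) else 0)) => //.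
move=> r j Dj; case: eqP => // rk.
have [j' jj'] : exists j' : 'I_i, j != j'.
  have i0 := ltnW i1.
  have [/eqP j0|j0] := boolP (j == Ordinal i0); last by exists (Ordinal i0).
  by exists (Ordinal i1); rewrite j0 -val_eqE.
apply: (multilin0_entries0 (j := j')); apply: wtsum_other jj' _.
by rewrite rk (leq_trans kD).
Qed.

Lemma multilin0_nseq_expand i D (t : R) :
  l (nseq i (\sum_(k < D) t ^+ k *: w k)) =
  \sum_(r : {ffun 'I_i -> 'I_D})
    t ^+ wtsum (fun j => r j) *: l (entries w (fun j => r j)).
Proof.
have -> : nseq i (\sum_(k < D) t ^+ k *: w k) =
    [seq \sum_(k < D) t ^+ k *: w k | j <- enum 'I_i].
  by rewrite -[in LHS](size_enum_ord i); elim: (enum _) => //= _ s ->.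
rewrite (multilin0_expand (fun _ (k : 'I_D) => t ^+ k *: w k))//; apply: eq_bigr => r _.
rewrite (multilin0_scale (fun j => t ^+ r j) (fun j => w (r j)))//.
by rewrite big_enum /= -expr_sum.
Qed.

Lemma multilin0_nseq_homog i D E (t : R) : (i * D < E)%N ->
  l (nseq i (\sum_(k < D) t ^+ k *: w k)) = \sum_(c < E) t ^+ c *: homog l w i D c.
Proof.
move=> iDE; rewrite multilin0_nseq_expand.
apply: (@sum_weight_scale R _ _ (fun r : {ffun 'I_i -> 'I_D} => wtsum (fun j => r j))).
by move=> r; apply: leq_ltn_trans iDE; exact: wtsum_bound.
Qed.

End OneMap.

End Compositions.

Section Recursion.
Variables (R : realType) (n m1 N : nat) (l : seq 'rV[R]_n -> 'rV[R]_m1).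
Variables (h1 : {linear 'rV[R]_m1 -> 'rV[R]_n}) (v : 'rV[R]_n).
Hypotheses (lP : multilin0 l) (lN : forall s, (N <= size s)%N -> l s = 0).

Lemma size_vlist k : size (vlist l h1 v k) = k.+1.
Proof. by elim: k => [|[|k] IH] //; rewrite [vlist _ _ _ _]/= size_rcons IH. Qed.

Lemma vlistS k : vlist l h1 v k.+2 =
  rcons (vlist l h1 v k.+1) (vstep l h1 (vlist l h1 v k.+1)).
Proof. by []. Qed.

Lemma nth_vlist k j : (j <= k)%N -> nth 0 (vlist l h1 v k) j = vseq l h1 v j.
Proof.
elim: k => [|k IH]; first by rewrite leqn0 => /eqP ->.
rewrite leq_eqVlt => /orP[/eqP ->//|]; rewrite ltnS => jk.
rewrite -IH//; case: k jk {IH} => [|k] jk; first by move: jk; rewrite leqn0 => /eqP ->.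
by rewrite vlistS nth_rcons size_vlist ltnS jk.
Qed.

Lemma vseqS k : vseq l h1 v k.+2 = vstep l h1 (vlist l h1 v k.+1).
Proof. by rewrite /vseq vlistS nth_rcons size_vlist ltnn eqxx. Qed.

(** The Taylor coefficients of [psi] at [t = 0]; dividing by the factorial absorbs the multinomial
    factors of the recursion. *)
Definition vcoef k : 'rV[R]_n := (k`!%:R)^-1 *: vseq l h1 v k.

Lemma vcoef0 : vcoef 0 = 0. Proof. by rewrite /vcoef /= scaler0. Qed.

Lemma vcoef1 : vcoef 1 = v. Proof. by rewrite /vcoef /vseq /= invr1 scale1r. Qed.

(* The equation [psi(t) = t v - h1 (F (psi(t)))], read off coefficientwise. *)
Lemma vcoef_rec D k : (k <= D)%N ->
  vcoef k = (k == 1%N)%:R *: v -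
    h1 (\sum_(2 <= i < N.+1) (i`!%:R)^-1 *: homog l vcoef i D k).
Proof.
move=> kD.
have [k1|] := leqP k 1.
  rewrite big_nat_cond big1 ?linear0 ?oppr0 ?addr0; last first.
    move=> i /andP[/andP[i2 _] _].
    by rewrite (homog_lt lP vcoef0) ?scaler0//; exact: leq_ltn_trans k1 i2.
  case: k k1 {kD} => [|[|//]] _; first by rewrite vcoef0 mulr0n scale0r ?addr0.
  by rewrite vcoef1 mulr1n scale1r ?addr0.
case: k kD => [//|[//|k]] kD _; rewrite mulr0n scale0r sub0r.
rewrite /vcoef vseqS /vstep size_vlist scalerN -linearZ/=; congr (- h1 _).
(* The two sums over arities stop at different places. Both extend to [C]: beyond [k.+2] no
   composition has only positive parts, and from arity [N] on the brackets vanish. *)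
set C := (maxn N.+1 k.+3).
rewrite (sum_nat_widen (b := C)) ?leq_maxr//; last first.
  move=> i _ ki; apply: big1 => r /andP[/eqP rk /forallP r0].
  have [|j] := @wtsum_lt i (fun j => r j); first by rewrite /wtsum rk.
  by move/eqP; rewrite -[_ == _]negbK -lt0n r0.
rewrite [RHS](sum_nat_widen (b := C)) ?leq_maxl//; last first.
  move=> i _ Ni; apply: (_ : _ *: (\sum_(_ | _) _) = 0).
  by rewrite big1 ?scaler0// => r _; rewrite lN// size_entries ltnW.
rewrite scaler_sumr big_nat [RHS]big_nat; apply: eq_bigr => i /andP[i2 _].
have -> : homog l vcoef i D k.+2 = homog l vcoef i k.+3 k.+2.
  rewrite (homog_widen lP vcoef0 (D2 := maxn D k.+3))// ?kD ?leq_maxl//.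
  by rewrite [RHS](homog_widen lP vcoef0 (D2 := maxn D k.+3))// leqnSn leq_maxr.
rewrite /homog big_mkcondr !scaler_sumr; apply: eq_bigr => r /eqP rk.
case: ifPn => [/forallP r0|/forallPn[j]]; last first.
  rewrite -eqn0Ngt => /eqP rj.
  by rewrite (multilin0_entries0 lP vcoef0 (j := j)) ?scaler0.
(* The index type allows the part [k.+2], which lies outside the list of known terms; such a part
   would make all others zero, against [r0]. *)
have -> : [seq nth 0 (vlist l h1 v k.+1) (r j) | j <- enum 'I_i] =
    [seq vseq l h1 v (r j) | j <- enum 'I_i].
  apply: eq_map => j; apply: nth_vlist; rewrite -ltnS ltn_neqAle -ltnS ltn_ord andbT.
  apply/eqP => rj.
  have [j' jj'] : exists j' : 'I_i, j != j'.
    have [/eqP j0|j0] := boolP (j == Ordinal (ltnW i2)); last by exists (Ordinal (ltnW i2)).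
    by exists (Ordinal i2); rewrite j0 -val_eqE.
  have := @wtsum_other i (fun j => r j) j j' jj'; rewrite {1}/wtsum rk rj => /(_ (leqnn _)) rj'.
  by have := r0 j'; rewrite rj'.
rewrite /entries (multilin0_scale (fun j => ((r j)`!%:R)^-1) (fun j => vseq l h1 v (r j)))//.
rewrite !scalerA; congr (_ *: _); rewrite big_enum /= prodfV.
rewrite [RHS]mulrC !mulrA mulVf ?mul1r//.
Qed.

End Recursion.

(** * Jacobi identities and the Maurer-Cartan series *)

Section HomogSmall.
Variables (R : realType) (n m : nat) (l : seq 'rV[R]_n -> 'rV[R]_m) (w : nat -> 'rV[R]_n).

Lemma homog0 D : homog l w 0 D 0 = l [::].
Proof.
rewrite /homog (eq_bigl xpredT); last by move=> r; rewrite /wtsum big_ord0.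
rewrite (eq_bigr (fun=> l [::])); last first.
  by move=> r _; congr l; apply: size0nil; rewrite size_entries.
by rewrite sumr_const card_ffun !card_ord expn0 mulr1n.
Qed.

Lemma homog1 D c : (c < D)%N -> homog l w 1 D c = l [:: w c].
Proof.
move=> cD; rewrite /homog (reindex (fun a : 'I_D => [ffun => a] : {ffun 'I_1 -> 'I_D}))/=.
  rewrite (big_pred1 (Ordinal cD)) /entries ?enum_ordSl /=.
    by rewrite (size0nil (s := enum 'I_0)) ?size_enum_ord//= ffunE.
  by move=> a; rewrite /wtsum big_ord1 ffunE.
apply: onW_bij; exists (fun r : {ffun 'I_1 -> 'I_D} => r ord0) => [a|r].
  by rewrite ffunE.
by apply/ffunP => j; rewrite ffunE (ord1 j).
Qed.

End HomogSmall.

Section Jacobi.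
Variables (R : realType) (n m1 m2 N : nat).
Variables (l : seq 'rV[R]_n -> 'rV[R]_m1) (l' : 'rV[R]_m1 -> seq 'rV[R]_n -> 'rV[R]_m2).
Hypothesis L : Linf_data N l l'.

Lemma Linf_l0 : l [::] = 0. Proof. by case: L. Qed.
Lemma Linf_multilin : multilin0 l. Proof. by case: L => _ []. Qed.
Lemma Linf_multilin' y : multilin0 (l' y).
Proof. by case: L => _ [_ [_ [H _]]]; exact: H. Qed.
Lemma Linf_linear' a y z s : l' (a *: y + z) s = a *: l' y s + l' z s.
Proof. by case: L => _ [_ [_ [_ [_ [H _]]]]]; exact: H. Qed.
Lemma Linf_jacobi k (x : 'I_k -> 'rV[R]_n) :
  \sum_(S : {set 'I_k} | S != finset.set0)
     l' (l [seq x i | i in S]) [seq x i | i in finset.setC S] = 0.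
Proof. by case: L => _ [_ [_ [_ [_ [_ [H _]]]]]]; exact: H. Qed.
Lemma Linf_strict s : (N <= size s)%N -> l s = 0.
Proof. by case: L => _ [_ [_ [_ [_ [_ [_ [H _]]]]]]]; exact: H. Qed.
Lemma Linf_strict' y s : (N <= (size s).+1)%N -> l' y s = 0.
Proof. by case: L => _ [_ [_ [_ [_ [_ [_ [_ H]]]]]]]; exact: H. Qed.

Lemma Linf_linear'0 s : l' 0 s = 0.
Proof.
have := Linf_linear' 1 0 0 s; rewrite !scale1r addr0 => /eqP.
by rewrite -subr_eq0 opprD addrA subrr sub0r oppr_eq0 => /eqP.
Qed.

Lemma Linf_linear'Z a y s : l' (a *: y) s = a *: l' y s.
Proof. by rewrite -[a *: y]addr0 Linf_linear' Linf_linear'0 addr0. Qed.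

Lemma Linf_linear'_sum (I : Type) (r : seq I) (P : pred I) F s :
  l' (\sum_(i <- r | P i) F i) s = \sum_(i <- r | P i) l' (F i) s.
Proof.
apply: (big_morph (fun y => l' y s)); last exact: Linf_linear'0.
by move=> y z; rewrite -[y in LHS]scale1r Linf_linear' scale1r.
Qed.

(** At equal arguments a subset matters only through its cardinality [a], shared by ['C(k, a)]
    subsets; the empty one may be included because [l [::] = 0]. *)
Lemma jacobi_diag k x :
  \sum_(a < k.+1) 'C(k, a)%:R *: l' (l (nseq a x)) (nseq (k - a) x) = 0.
Proof.
pose f a := l' (l (nseq a x)) (nseq (k - a) x).
have fS : \sum_(S : {set 'I_k}) f #|S| = 0.
  rewrite (bigD1 finset.set0)//= cards0 {1}/f Linf_l0 Linf_linear'0 add0r.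
  rewrite -[RHS](@Linf_jacobi k (fun=> x)); apply: eq_bigr => S _.
  have E (A : {set 'I_k}) : [seq x | i in A] = nseq #|A| x.
    by rewrite cardE /image_mem; elim: (enum _) => //= ? ? ->.
  have kS : (k - #|S| = #|finset.setC S|)%N.
    by apply/eqP; rewrite -(eqn_add2l #|S|) cardsC card_ord subnKC//; have := max_card (mem S); rewrite card_ord.
  by rewrite /f !E kS.
transitivity (\sum_(a < k.+1) \sum_(S : {set 'I_k} | #|S| == a) f #|S|).
  apply: eq_bigr => a _; rewrite (eq_bigr (fun=> f a)); last by move=> S /eqP ->.
  rewrite sumr_const scaler_nat; congr (_ *+ _).
  have := card_draws 'I_k a.
  by rewrite card_ord => <-; apply: eq_card => S; rewrite !inE.
rewrite sum_by_weight -[RHS]fS; apply: eq_bigl => S.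
by have := max_card (mem S); rewrite card_ord ltnS.
Qed.

Lemma MC_ord M x : (N <= M)%N -> MC N l x = \sum_(a < M) (a`!%:R)^-1 *: l (nseq a x).
Proof.
move=> NM; rewrite -(big_mkord xpredT (fun a => (a`!%:R)^-1 *: l (nseq a x))).
have H b : (N <= b)%N -> \sum_(0 <= a < b) (a`!%:R)^-1 *: l (nseq a x) =
    \sum_(0 <= a < N) (a`!%:R)^-1 *: l (nseq a x).
  move=> Nb; rewrite (sum_nat_widen (a := N) (b := b))// => i _ Ni.
  by rewrite Linf_strict ?scaler0// size_nseq.
rewrite H// -(H N.+1)// big_ltn// /MC.
by rewrite [in RHS]/= Linf_l0 scaler0 add0r.
Qed.

(** The Bianchi identity: the differential twisted by [x] annihilates the curvature [MC N l x]. It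
    is the sum over [c] of [jacobi_diag] divided by [c!]. *)
Lemma jacobi_MC x : \sum_(p < N.+1) (p`!%:R)^-1 *: l' (MC N l x) (nseq p x) = 0.
Proof.
pose H a p := (a`!%:R * p`!%:R)^-1 *: l' (l (nseq a x)) (nseq p x).
(* Large enough for the triangle [a + p < C] to contain every nonzero term of the rectangle. *)
pose C := (N + N.+1)%N.
transitivity (\sum_(a < C) \sum_(p < C - a) H a p).
  transitivity (\sum_(p < N.+1) \sum_(a < C) H a p).
    apply: eq_bigr => p _; rewrite (@MC_ord C) ?leq_addr// Linf_linear'_sum scaler_sumr.
    by apply: eq_bigr => a _; rewrite Linf_linear'Z scalerA /H invfM mulrC.
  rewrite exchange_big /=; apply: eq_bigr => a _.
  have [Na|aN] := leqP N a.
    by rewrite !big1// => p _; rewrite /H Linf_strict ?size_nseq// Linf_linear'0 scaler0.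
  rewrite -!(big_mkord xpredT (H a)).
  apply: sum_nat_widen => [|p _ Np].
    have : (a + N < N + N.+1)%N by rewrite addnS ltnS leq_add2r ltnW.
    by rewrite ltn_subRL.
  by rewrite /H Linf_strict' ?scaler0// size_nseq ltnW// ltnW.
rewrite -sum_triangle big1// => c _.
have := congr1 (fun y => (c`!%:R)^-1 *: y) (jacobi_diag c x).
rewrite scaler0 => J; rewrite -[RHS]J scaler_sumr; apply: eq_bigr => a _.
rewrite /H scalerA; congr (_ *: _).
have ac : (a <= c)%N by rewrite -ltnS.
have bnz : ('C(c, a)%:R : R) != 0 by rewrite pnatr_eq0 -lt0n bin_gt0.
rewrite -[in RHS](bin_fact ac) !natrM [in RHS]invfM.
by rewrite mulrAC mulVf// mul1r.
Qed.

Lemma jacobi_l1 x : l' (l [:: x]) [::] = 0.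
Proof.
have := jacobi_diag 1 x; rewrite big_ord_recl big_ord1 /= Linf_l0 Linf_linear'0.
by rewrite scaler0 add0r scale1r.
Qed.

Section Formal.
Variables (h1 : {linear 'rV[R]_m1 -> 'rV[R]_n}) (h2 : {linear 'rV[R]_m2 -> 'rV[R]_m1}).
Hypothesis hP : forall y, l [:: h1 y] + h2 (l' y [::]) = y.
Variables (D : nat) (w : nat -> 'rV[R]_n) (v : 'rV[R]_n).
Hypotheses (w0 : w 0%N = 0) (lv : l [:: v] = 0).
Hypothesis wrec : forall k, (k < D)%N -> w k = (k == 1%N)%:R *: v -
    h1 (\sum_(2 <= i < N.+1) (i`!%:R)^-1 *: homog l w i D k).

(** The coefficient of [t ^+ c] in [MC] along the polynomial curve with coefficients [w k],
    [k < D]. *)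
Definition MCcoef c := \sum_(1 <= i < N.+1) (i`!%:R)^-1 *: homog l w i D c.

Lemma MC_MCcoef E t : (N.+1 * D < E)%N ->
  MC N l (\sum_(k < D) t ^+ k *: w k) = \sum_(c < E) t ^+ c *: MCcoef c.
Proof.
move=> DE; rewrite /MC (eq_big_nat _ _ (F2 := fun i =>
   \sum_(c < E) t ^+ c *: ((i`!%:R)^-1 *: homog l w i D c))); last first.
  move=> i /andP[_ iN]; rewrite (multilin0_nseq_homog _ Linf_multilin (E := E)).
    by rewrite scaler_sumr; apply: eq_bigr => c _; rewrite !scalerA mulrC.
  by apply: leq_ltn_trans DE; rewrite leq_mul2r (ltnW iN) orbT.
by rewrite exchange_big; apply: eq_bigr => c _; rewrite scaler_sumr.
Qed.

Lemma MCcoef_split c : (c < D)%N -> MCcoef c =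
  l [:: w c] + \sum_(2 <= i < N.+1) (i`!%:R)^-1 *: homog l w i D c.
Proof.
move=> cD; have [N0|N0] := posnP N.
  rewrite /MCcoef !big_geq ?N0// Linf_strict ?addr0//.
  by rewrite N0.
by rewrite /MCcoef big_ltn// homog1// invr1 scale1r.
Qed.

(* [l' _ [::]] kills the first nonzero coefficient of [MC] by the Jacobi
   identity, while [h2 (l' _ [::])] fixes it by the recursion. *)
Lemma MCcoef_eq0 c : (c < D)%N -> MCcoef c = 0.
Proof.
(* [E] exceeds the degree in [t] of every bracket evaluated on the curve, and [G (a, b)] is the
   contribution of degree [a] from [MC] and degree [b] from the remaining arguments. *)
pose E := (N.+1 * D).+1.
pose G (ab : 'I_E * 'I_E) := \sum_(p < N.+1) (p`!%:R)^-1 *: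
   homog (l' (MCcoef ab.1)) w p D ab.2.
have J (t : R) : \sum_(c < E + E)
    t ^+ c *: \sum_(ab : 'I_E * 'I_E | (ab.1 + ab.2)%N == c) G ab = 0.
  rewrite -(sum_weight_scale (wt := fun ab : 'I_E * 'I_E => (ab.1 + ab.2)%N)); last first.
    by move=> [a b] /=; rewrite -addSn leq_add// ltnW.
  rewrite -[RHS](jacobi_MC (\sum_(k < D) t ^+ k *: w k)) (MC_MCcoef (E := E))//.
  under [RHS]eq_bigr => p _.
    rewrite Linf_linear'_sum scaler_sumr.
    under eq_bigr => a _.
      rewrite Linf_linear'Z (multilin0_nseq_homog _ (@Linf_multilin' _) (E := E)); last first.
        by rewrite /E ltnS leq_mul2r (ltnW (ltn_ord p)) orbT.
      rewrite !scaler_sumr. over.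
    rewrite pair_big /=. over.
  rewrite exchange_big; apply: eq_bigr => ab _; rewrite scaler_sumr; apply: eq_bigr => p _.
  by rewrite !scalerA exprD; congr (_ *: _); rewrite mulrC mulrA.
elim/ltn_ind: c => c IH cD.
have cE : (c < E)%N.
  by apply: (leq_trans cD); rewrite /E mulSn leqW// leq_addr.
(* Degree [c] of the Bianchi identity: pairs with [a < c] vanish by induction, leaving [(c, 0)];
   there only [p = 0] survives, since degree zero in [p > 0] arguments involves [w 0 = 0]. *)
have l'mc : l' (MCcoef c) [::] = 0.
  have := vector_poly_eq0
    (u := fun c => \sum_(ab : 'I_E * 'I_E | (ab.1 + ab.2)%N == c) G ab) J (ltn_addr E cE).
  rewrite (bigD1 (Ordinal cE, ord0)) /=; last by rewrite addn0.
  rewrite [X in _ + X]big1 ?addr0; last first.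
    move=> [a b] /= /andP[/eqP abc ab]; apply: big1 => p _ /=.
    have ac : (a < c)%N.
      rewrite -abc -[X in (X < _)%N]addn0 ltn_add2l lt0n; apply: contraNneq ab => b0.
      by apply/eqP; congr (_, _); apply/val_inj; rewrite //= -abc b0 addn0.
    by rewrite /homog IH// ?(ltn_trans ac)// big1 ?scaler0// => r _; rewrite Linf_linear'0.
  rewrite /G big_ord_recl /= homog0 invr1 scale1r big1 ?addr0// => p _.
  by rewrite (homog_lt (@Linf_multilin' _) w0)// scaler0.
set f := \sum_(2 <= i < N.+1) (i`!%:R)^-1 *: homog l w i D c.
have mcE : MCcoef c = l [:: w c] + f by rewrite MCcoef_split.
have l'f : l' f [::] = 0.
  by move: l'mc; rewrite mcE -[l _]scale1r Linf_linear' scale1r jacobi_l1 add0r.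
(* Since [f] is a cocycle, the homotopy identity gives [l [:: h1 f] = f], so [l [:: w c] = - f]
   cancels the nonlinear part. *)
rewrite mcE wrec// -/f -(multilin0_zero [::] [::] Linf_multilin).
have -> : (c == 1%N)%:R *: v - h1 f = (c == 1%N)%:R *: v + (-1) *: h1 f by rewrite scaleN1r.
rewrite (multilin0D [::])//; last exact: Linf_multilin.
rewrite !(multilin0Z [::] [::] _ _ Linf_multilin)/= lv scaler0 add0r scaleN1r.
have := hP f; rewrite l'f linear0 addr0 => ->.
by rewrite addNr (multilin0_zero [::] [::] Linf_multilin).
Qed.

End Formal.
End Jacobi.

(** * Majorant estimates *)

Section Estimates.
Variables (R : realType) (n m1 : nat) (l : seq 'rV[R]_n -> 'rV[R]_m1).
Variables (nrm0 : 'rV[R]_n -> R) (nrm1 : 'rV[R]_m1 -> R).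
Hypotheses (n0P : is_norm nrm0) (n1P : is_norm nrm1) (lP : multilin0 l).

Definition bracket_norm i : R := opnorm_l nrm0 nrm1 l i / i`!%:R.

Local Notation lam := bracket_norm.

Lemma bracket_norm_ge0 i : 0 <= lam i.
Proof. by rewrite divr_ge0//; case: (opnorm_lP n0P n1P lP). Qed.

Lemma nrm1_scaled_le s :
  nrm1 (((size s)`!%:R)^-1 *: l s) <= lam (size s) * \prod_(x <- s) nrm0 x.
Proof.
rewrite (is_normZ n1P) ger0_norm ?invr_ge0// /bracket_norm mulrAC [leLHS]mulrC ler_wpM2r ?invr_ge0//.
by have [_] := opnorm_lP n0P n1P lP; exact.
Qed.

Lemma sum_prod_ffun (B : nat -> R) i D :
  \sum_(r : {ffun 'I_i -> 'I_D}) \prod_(j < i) B (r j) = (\sum_(k < D) B k) ^+ i.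
Proof.
rewrite -(bigA_distr_bigA (fun (_ : 'I_i) (k : 'I_D) => B k)).
by rewrite prodr_const card_ord.
Qed.

Lemma nrm1_entries_le (w : nat -> 'rV[R]_n) i D (P : pred {ffun 'I_i -> 'I_D}) :
  nrm1 ((i`!%:R)^-1 *: \sum_(r | P r) l (entries w (fun j => r j))) <=
  lam i * \sum_(r : {ffun 'I_i -> 'I_D} | P r) \prod_(j < i) nrm0 (w (r j)).
Proof.
rewrite scaler_sumr (le_trans (is_norm_sum n1P _ _ _))// mulr_sumr ler_sum// => r _.
have := nrm1_scaled_le (entries w (fun j => r j)).
by rewrite size_entries big_map big_enum.
Qed.

(* Trading the factor [2 ^ (r_1 + ... + r_i)] for the decay [2 ^- D]. *)
Lemma prod_tail_le (b : nat -> R) i D g : (forall k, 0 <= b k) ->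
  \sum_(k < D) 2 ^+ k * b k <= g ->
  \sum_(r : {ffun 'I_i -> 'I_D} | (D <= wtsum (fun j => r j))%N) \prod_(j < i) b (r j)
    <= 2 ^- D * g ^+ i.
Proof.
move=> b0 bg; have g0 : 0 <= \sum_(k < D) 2 ^+ k * b k.
  by rewrite sumr_ge0// => k _; rewrite mulr_ge0// exprn_ge0.
apply: (@le_trans _ _ (2 ^- D * (\sum_(k < D) 2 ^+ k * b k) ^+ i)); last first.
  rewrite ler_wpM2l ?invr_ge0 ?exprn_ge0// lerXn2r// nnegrE//.
  exact: le_trans g0 bg.
rewrite -(sum_prod_ffun (fun k => 2 ^+ k * b k)) mulr_sumr.
rewrite [leRHS](bigID (fun r : {ffun 'I_i -> 'I_D} => D <= wtsum (fun j => r j))%N)/=.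
rewrite -[leLHS]addr0 lerD//; last first.
  rewrite sumr_ge0// => r _; rewrite mulr_ge0 ?invr_ge0 ?exprn_ge0// prodr_ge0// => j _.
  by rewrite mulr_ge0// exprn_ge0.
apply: ler_sum => r Dr; rewrite ler_pdivlMl ?exprn_gt0// big_split /=.
rewrite ler_wpM2r ?prodr_ge0// -expr_sum; apply: ler_weXn2l => //.
by rewrite ler1n.
Qed.

Section Majorant.
Variables (N : nat) (h1 : {linear 'rV[R]_m1 -> 'rV[R]_n}) (v : 'rV[R]_n).
Hypothesis lN : forall s, (N <= size s)%N -> l s = 0.
Local Notation a := (opnorm_h1 nrm0 nrm1 h1).
Local Notation w := (vcoef l h1 v).

Variable g : R.
Hypotheses (g0 : 0 <= g)
  (vg : 2 * nrm0 v + a * \sum_(2 <= i < N.+1) lam i * g ^+ i <= g).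

Let a0 : 0 <= a. Proof. by case: (opnorm_h1P h1 n0P n1P). Qed.
Let h1a y : nrm0 (h1 y) <= a * nrm1 y. Proof. by case: (opnorm_h1P h1 n0P n1P). Qed.

(** Majorant induction: the weights [2 ^+ k] multiply along compositions, so the recursion bounds
    the next partial sum by the left side of [vg] once the previous one is at most [g]. The weights
    yield the decay [2 ^- k] of the coefficients. *)
Lemma vcoef_sum_le D : \sum_(k < D) 2 ^+ k * nrm0 (w k) <= g.
Proof.
elim: D => [|D IH]; first by rewrite big_ord0.
pose B k := 2 ^+ k * nrm0 (w k).
have B0 k : 0 <= B k by rewrite mulr_ge0 ?exprn_ge0 ?(is_norm_ge0 n0P).
pose Q i k := \sum_(r : {ffun 'I_i -> 'I_D} | wtsum (fun j => r j) == k) \prod_(j < i) B (r j).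
(* Truncating the parts at [D] is legitimate even for [k = D], so only terms covered by the
   induction hypothesis occur. *)
have step (k : 'I_D.+1) : B k <= (k == 1%N :> nat)%:R * (2 * nrm0 v) +
    a * \sum_(2 <= i < N.+1) lam i * Q i k.
  have kD : (k <= D)%N by rewrite -ltnS.
  rewrite /B (vcoef_rec h1 v lP lN kD).
  apply: (@le_trans _ _ (2 ^+ k * ((k == 1%N :> nat)%:R * nrm0 v +
      a * \sum_(2 <= i < N.+1) lam i *
        \sum_(r : {ffun 'I_i -> 'I_D} | wtsum (fun j => r j) == k)
          \prod_(j < i) nrm0 (w (r j))))).
    rewrite ler_wpM2l ?exprn_ge0// (le_trans (is_norm_leD n0P _ _))// lerD//.
      by rewrite (is_normZ n0P) normr_nat.
    rewrite (is_normN n0P) (le_trans (h1a _))// ler_wpM2l//.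
    rewrite (le_trans (is_norm_sum n1P _ _ _))// ler_sum// => i _.
    exact: nrm1_entries_le.
  rewrite mulrDr lerD//.
    by case: eqP => [->|_]; rewrite ?mul0r ?mulr0// !mul1r expr1.
  rewrite mulrCA ler_wpM2l// mulr_sumr ler_sum// => i _.
  rewrite mulrCA ler_wpM2l ?bracket_norm_ge0// mulr_sumr ler_sum// => r /eqP rk.
  by rewrite -{1}rk /B big_split /= expr_sum.
apply: le_trans vg.
apply: (@le_trans _ _ (\sum_(k < D.+1) ((k == 1%N :> nat)%:R * (2 * nrm0 v) +
    a * \sum_(2 <= i < N.+1) lam i * Q i k))).
  by apply: ler_sum => k _; exact: step.
rewrite big_split /= lerD//.
  rewrite -mulr_suml ler_piMl ?mulr_ge0 ?(is_norm_ge0 n0P)//.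
  rewrite big_ord_recl /= add0r; case: (D) => [|D']; first by rewrite big_ord0.
  by rewrite big_ord_recl big1 ?addr0.
rewrite -mulr_sumr ler_wpM2l// exchange_big /= ler_sum// => i _.
rewrite -mulr_sumr ler_wpM2l ?bracket_norm_ge0// /Q sum_by_weight.
apply: (@le_trans _ _ ((\sum_(k < D) B k) ^+ i)); last first.
  by rewrite lerXn2r// nnegrE sumr_ge0.
rewrite -(sum_prod_ffun B) [leRHS](bigID (fun r : {ffun 'I_i -> 'I_D} =>
   wtsum (fun j => r j) < D.+1)%N)/=.
by rewrite lerDl sumr_ge0// => r _; rewrite prodr_ge0.
Qed.

(** Partial sums of the series for [Psi]. *)
Definition vsum D := \sum_(k < D) w k.

Lemma nseq_vsum_expand i D : l (nseq i (vsum D)) =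
  \sum_(r : {ffun 'I_i -> 'I_D}) l (entries w (fun j => r j)).
Proof.
have := multilin0_nseq_expand w lP i D 1; under eq_bigr do rewrite expr1n scale1r.
by move=> ->; apply: eq_bigr => r _; rewrite expr1n scale1r.
Qed.

(** Weights below [D] give complete coefficients, subject to the formal identities; heavier weights
    form the truncation error. *)
Lemma nseq_vsum_split i D : l (nseq i (vsum D)) = \sum_(c < D) homog l w i D c +
  \sum_(r : {ffun 'I_i -> 'I_D} | (D <= wtsum (fun j => r j))%N) l (entries w (fun j => r j)).
Proof.
rewrite nseq_vsum_expand sum_by_weight.
rewrite (bigID (fun r : {ffun 'I_i -> 'I_D} => wtsum (fun j => r j) < D)%N)/=.
by congr (_ + _); apply: eq_bigl => r; rewrite -leqNgt.
Qed.

Lemma nrm1_tail_le m D :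
  nrm1 (\sum_(m <= i < N.+1) (i`!%:R)^-1 *:
    \sum_(r : {ffun 'I_i -> 'I_D} | (D <= wtsum (fun j => r j))%N) l (entries w (fun j => r j)))
  <= 2 ^- D * \sum_(m <= i < N.+1) lam i * g ^+ i.
Proof.
rewrite (le_trans (is_norm_sum n1P _ _ _))// mulr_sumr ler_sum// => i _.
rewrite (le_trans (nrm1_entries_le _ _))// mulrCA ler_wpM2l ?bracket_norm_ge0//.
apply: (prod_tail_le (b := fun k => nrm0 (w k))) (vcoef_sum_le D) => k.
exact: is_norm_ge0.
Qed.

Lemma vcoef_le k : nrm0 (w k) <= 2 ^- k * g.
Proof.
rewrite ler_pdivlMl ?exprn_gt0//.
apply: le_trans (vcoef_sum_le k.+1); rewrite big_ord_recr /= lerDr sumr_ge0// => j _.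
by rewrite mulr_ge0 ?exprn_ge0 ?(is_norm_ge0 n0P).
Qed.

Lemma nrm0_vsum_le D : nrm0 (vsum D) <= g.
Proof.
apply: le_trans (vcoef_sum_le D); rewrite (le_trans (is_norm_sum n0P _ _ _))//.
apply: ler_sum => k _; rewrite ler_peMl ?(is_norm_ge0 n0P)// exprn_ege1//.
by rewrite ler1n.
Qed.

End Majorant.
End Estimates.

(** * Continuity of the polynomial maps built from the brackets *)

Section PolynomialContinuity.
Variables (R : realType) (n : nat).

Lemma subalgebra_continuous (T : topologicalType) :
  subalgebra (fun f : T -> R => continuous f).
Proof.
split=> [c|f g cf cg|f g cf cg] x.
- exact: cst_continuous.
- by apply: continuousD; [exact: cf|exact: cg].
- by apply: continuousM; [exact: cf|exact: cg].
Qed.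

Variables (m : nat) (l : seq 'rV[R]_n -> 'rV[R]_m).
Hypothesis lP : multilin0 l.

Lemma subalg_nseq (T : Type) (C : (T -> R) -> Prop) (f : T -> 'rV[R]_n) i c :
  subalgebra C -> (forall b, C (fun t => f t 0 b)) -> C (fun t => l (nseq i (f t)) 0 c).
Proof.
move=> CP fC.
have E t : nseq i (f t) = [seq f t | j <- nseq i tt].
  by elim: i => //= i ->.
under eq_fun do rewrite E.
by apply: (@subalg_multilin0 _ _ _ CP _ _ l _ (nseq i tt) (fun=> f) c lP) => _ b.
Qed.

End PolynomialContinuity.

Section Nonlinear.
Variables (R : realType) (n m1 N : nat) (l : seq 'rV[R]_n -> 'rV[R]_m1).
Variables (h1 : {linear 'rV[R]_m1 -> 'rV[R]_n}).
Hypothesis lP : multilin0 l.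

Definition nonlin x := \sum_(2 <= i < N.+1) (i`!%:R)^-1 *: l (nseq i x).

Lemma subalg_nonlin (T : Type) (C : (T -> R) -> Prop) (f : T -> 'rV[R]_n) c :
  subalgebra C -> (forall b, C (fun t => f t 0 b)) -> C (fun t => nonlin (f t) 0 c).
Proof.
move=> CP fC; under eq_fun do rewrite summxE.
apply: (subalg_sum CP) => i; under eq_fun do rewrite mxE.
by apply: (subalgM CP); [exact: subalgC|exact: (subalg_nseq lP _ _ CP fC)].
Qed.

Lemma subalg_MC (T : Type) (C : (T -> R) -> Prop) (f : T -> 'rV[R]_n) c :
  subalgebra C -> (forall b, C (fun t => f t 0 b)) -> C (fun t => MC N l (f t) 0 c).
Proof.
move=> CP fC; under eq_fun do rewrite summxE.
apply: (subalg_sum CP) => i; under eq_fun do rewrite mxE.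
by apply: (subalgM CP); [exact: subalgC|exact: (subalg_nseq lP _ _ CP fC)].
Qed.

End Nonlinear.

(** Transfers equations to the limit: partial sums satisfy them up to a geometrically small
    residual. *)
Lemma lim_eq0_of_geometric (R : realType) n (f : 'rV[R]_n -> R) (u : nat -> 'rV[R]_n) x K :
  continuous f -> u @ \oo --> x -> (forall D, (2 <= D)%N -> `|f (u D)| <= 2 ^- D * K) ->
  f x = 0.
Proof.
move=> cf ux H.
have fu : f \o u @ \oo --> f x by exact: (cvg_comp _ _ ux (cf x)).
have gu : (fun D => f (u D)) @ \oo --> (0 : R).
  apply/norm_cvg0P.
  apply: (@squeeze_cvgr _ _ _ _ (fun=> 0) (fun D => geometric K (2^-1) D)).
  - near=> D; rewrite normr_ge0 /= (le_trans (H _ _))//; last first.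
      by rewrite /geometric /= mulrC exprVn.
    by near: D; exists 2.
  - exact: cvg_cst.
  - by apply: cvg_geometric; rewrite ger0_norm ?invr_ge0// invf_lt1// ltr1n.
exact: (cvg_unique _ fu gu).
Unshelve. all: by end_near. Qed.

(* Restating completeness makes HB build the missing join with normed modules,
   so that [normed_cvg] applies to row vectors. *)
HB.instance Definition _ (R : realType) n := Complete.on 'rV[R]_n.

(** * Convergence of the series and the fixed-point equation *)

Section PsiLimit.
Variables (R : realType) (n m1 N : nat) (l : seq 'rV[R]_n -> 'rV[R]_m1).
Variables (nrm0 : 'rV[R]_n -> R) (nrm1 : 'rV[R]_m1 -> R).
Hypotheses (n0P : is_norm nrm0) (n1P : is_norm nrm1) (lP : multilin0 l).
Hypothesis lN : forall s, (N <= size s)%N -> l s = 0.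
Variables (h1 : {linear 'rV[R]_m1 -> 'rV[R]_n}) (v : 'rV[R]_n).
Local Notation a := (opnorm_h1 nrm0 nrm1 h1).
Local Notation lam := (bracket_norm l nrm0 nrm1).
Local Notation w := (vcoef l h1 v).
Local Notation vsum := (vsum l h1 v).
Local Notation F := (nonlin N l).

Variable g : R.
Hypotheses (g0 : 0 <= g)
  (vg : 2 * nrm0 v + a * \sum_(2 <= i < N.+1) lam i * g ^+ i <= g).

Let a0 : 0 <= a. Proof. by case: (opnorm_h1P h1 n0P n1P). Qed.
Let h1a y : nrm0 (h1 y) <= a * nrm1 y. Proof. by case: (opnorm_h1P h1 n0P n1P). Qed.

(** The recursion cancels all weights below [D], leaving only [h1] of the truncation error. *)
Lemma vsum_residual D : (2 <= D)%N ->
  nrm0 (vsum D + h1 (F (vsum D)) - v) <= 2 ^- D * g.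
Proof.
move=> D2; pose T := \sum_(2 <= i < N.+1) (i`!%:R)^-1 *:
  \sum_(r : {ffun 'I_i -> 'I_D} | (D <= wtsum (fun j => r j))%N) l (entries w (fun j => r j)).
have -> : vsum D + h1 (F (vsum D)) - v = h1 T.
  have -> : F (vsum D) =
      \sum_(2 <= i < N.+1) (i`!%:R)^-1 *: (\sum_(c < D) homog l w i D c) + T.
    rewrite -big_split /=; apply: eq_bigr => i _.
    by rewrite (nseq_vsum_split lP) scalerDr.
  have -> : vsum D = v -
      h1 (\sum_(2 <= i < N.+1) (i`!%:R)^-1 *: (\sum_(c < D) homog l w i D c)).
    rewrite {1}/vsum (eq_bigr (fun k : 'I_D => (k == 1%N :> nat)%:R *: v -
      h1 (\sum_(2 <= i < N.+1) (i`!%:R)^-1 *: homog l w i D k))); last first.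
      by move=> k _; apply: vcoef_rec => //; exact/ltnW.
    rewrite sumrB; congr (_ - _).
      (* [2 <= D] ensures that index 1, which carries [v], is among the summands. *)
      rewrite (bigD1 (Ordinal D2))//= scale1r big1 ?addr0// => k k1.
      by rewrite (_ : (k == 1%N :> nat) = false) ?scale0r//; exact: negbTE.
    rewrite -linear_sum exchange_big /=; congr (h1 _); apply: eq_bigr => i _.
    by rewrite scaler_sumr.
  by rewrite linearD addrA subrK addrAC subrr add0r.
apply: (le_trans (h1a _)).
have := nrm1_tail_le n0P n1P lP lN g0 vg 2 D; rewrite -/T => H.
apply: (le_trans (ler_wpM2l a0 H)); rewrite mulrCA ler_wpM2l ?invr_ge0 ?exprn_ge0//.
by apply: le_trans vg; rewrite lerDr mulr_ge0// (is_norm_ge0 n0P).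
Qed.

(** [vcoef_le] dominates the series by a geometric one of ratio [1/2], so the [limn] in [psi] is a
    genuine limit. *)
Lemma vsum_cvg : vsum @ \oo --> Psi l h1 v.
Proof.
have E : (fun M => \sum_(k < M) ((1 ^+ k) / k`!%:R) *: vseq l h1 v k) = vsum.
  by apply/funext => M; apply: eq_bigr => k _; rewrite expr1n mul1r.
rewrite /Psi /psi E.
have -> : vsum = series w by apply/funext => M; rewrite /series /= big_mkord.
suff : cvgn (series w) by [].
apply: (@normed_cvg R 'rV[R]_n).
have [C C0 wC] := is_norm_ge_mx n0P.
apply: (@series_le_cvg _ _ (geometric (C * g) 2^-1)).
- by move=> k; exact: normr_ge0.
- by move=> k; rewrite /geometric /= mulr_ge0 ?exprn_ge0 ?invr_ge0// mulr_ge0// ltW.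
- move=> k /=; rewrite (le_trans (wC _))// /geometric /= -mulrA ler_wpM2l ?(ltW C0)//.
  rewrite mulrC exprVn.
  exact: (vcoef_le n0P n1P lP lN g0 vg).
- by apply: is_cvg_geometric_series; rewrite ger0_norm ?invr_ge0// invf_lt1// ltr1n.
Qed.

Lemma Psi_le : nrm0 (Psi l h1 v) <= g.
Proof.
have H : nrm0 (vsum D) @[D --> \oo] --> nrm0 (Psi l h1 v).
  by apply: continuous_cvg; [exact: is_norm_continuous|exact: vsum_cvg].
apply: (cvgr_to_le H); apply: nearW => D.
exact: (nrm0_vsum_le n0P n1P lP lN g0 vg).
Qed.

Lemma Psi_fixpoint : Psi l h1 v + h1 (F (Psi l h1 v)) = v.
Proof.
have [C C0 wC] := is_norm_ge_mx n0P.
apply/eqP; rewrite -subr_eq0; apply/eqP/rowP => j; rewrite [RHS]mxE.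
apply: (lim_eq0_of_geometric (f := fun x => (x + h1 (F x) - v) 0 j) (K := C * g) _ vsum_cvg).
  have CP := subalgebra_continuous R 'rV[R]_n.
  have cid b : continuous (fun x : 'rV[R]_n => x 0 b) by exact: coord_continuous.
  have -> : (fun x => (x + h1 (F x) - v) 0 j) =
    (fun x => x 0 j + h1 (F x) 0 j + - v 0 j).
    by apply/funext => x; rewrite !mxE.
  apply: (subalgD CP); last exact: subalgC CP _.
  apply: (subalgD CP) => //; apply: (subalg_linear CP) => b.
  exact: (@subalg_nonlin _ _ _ N l lP _ _ (fun x => x) b CP cid).
move=> D D2; rewrite (le_trans (mx_coord_le _ _ _))// (le_trans (wC _))//.
by rewrite mulrCA ler_wpM2l ?(ltW C0)// vsum_residual.
Qed.

End PsiLimit.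

(** * The Maurer-Cartan equation at the limit and the choice of the radius *)

Section Radius.
Variables (R : realType) (n m1 m2 N : nat).
Variables (l : seq 'rV[R]_n -> 'rV[R]_m1) (l' : 'rV[R]_m1 -> seq 'rV[R]_n -> 'rV[R]_m2).
Variables (h1 : {linear 'rV[R]_m1 -> 'rV[R]_n}) (h2 : {linear 'rV[R]_m2 -> 'rV[R]_m1}).
Variables (nrm0 : 'rV[R]_n -> R) (nrm1 : 'rV[R]_m1 -> R).
Hypotheses (L : Linf_data N l l').
Hypothesis hP : forall y, l [:: h1 y] + h2 (l' y [::]) = y.
Hypotheses (n0P : is_norm nrm0) (n1P : is_norm nrm1).
Local Notation a := (opnorm_h1 nrm0 nrm1 h1).
Local Notation lam := (bracket_norm l nrm0 nrm1).
Local Notation alpha := (alpha_l nrm0 nrm1 N l).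

Let lP := Linf_multilin L.
Let lN := Linf_strict L.
Let a0 : 0 <= a. Proof. by case: (opnorm_h1P h1 n0P n1P). Qed.
Let lam0 i : 0 <= lam i. Proof. exact: bracket_norm_ge0. Qed.

(** By [MCcoef_eq0] the coefficients of weight below [D] vanish exactly, so [MC] at the partial sum
    is the tail alone, of order [2 ^- D]. *)
Lemma MC_Psi v g : 0 <= g ->
  2 * nrm0 v + a * \sum_(2 <= i < N.+1) lam i * g ^+ i <= g ->
  l [:: v] = 0 -> MC N l (Psi l h1 v) = 0.
Proof.
move=> g0 vg lv; have [C C0 wC] := is_norm_ge_mx n1P.
apply/rowP => j; rewrite [RHS]mxE.
apply: (lim_eq0_of_geometric (f := fun x => MC N l x 0 j)
  (K := C * \sum_(1 <= i < N.+1) lam i * g ^+ i) _ (vsum_cvg n0P n1P lP lN g0 vg)).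
  have CP := subalgebra_continuous R 'rV[R]_n.
  have cid b : continuous (fun x : 'rV[R]_n => x 0 b) by exact: coord_continuous.
  exact: (@subalg_MC _ _ _ N l lP _ _ (fun x => x) j CP cid).
move=> D D2; rewrite (le_trans (mx_coord_le _ _ _))// (le_trans (wC _))//.
rewrite mulrCA ler_wpM2l ?(ltW C0)//.
rewrite /MC; under eq_bigr do rewrite (nseq_vsum_split lP) scalerDr.
rewrite big_split /=.
under eq_bigr do rewrite scaler_sumr.
rewrite exchange_big /= big1 ?add0r; first exact: (nrm1_tail_le n0P n1P lP lN g0 vg).
move=> c _; apply: (MCcoef_eq0 L hP (vcoef0 l h1 v) lv) => // k kD.
exact/(vcoef_rec h1 v lP lN)/ltnW.
Qed.

(* Injectivity of [l' _ [::]] leaves only the total subset in the Jacobi identity, by induction on arity. *)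
Lemma Linf_trivial : (forall y, l' y [::] = 0 -> y = 0) -> forall s, l s = 0.
Proof.
move=> inj s; have [k] := ubnP (size s); elim: k s => // k IH s; rewrite ltnS => sk.
have [/size0nil ->|s0] := posnP (size s); first exact: Linf_l0 L.
apply: inj; pose x (i : 'I_(size s)) := nth 0 s i.
have := Linf_jacobi L x.
have T0 : finset.setTfor 'I_(size s) != finset.set0.
  by rewrite -card_gt0 cardsT card_ord.
rewrite (bigD1 (finset.setTfor 'I_(size s)))//= big1 ?addr0; last first.
  move=> S /andP[_ ST]; rewrite IH ?(Linf_linear'0 L)// size_map -cardE.
  apply: leq_trans sk.
  have : (#|S| < #|finset.setTfor 'I_(size s)|)%N.
    by apply: proper_card; rewrite finset.properEneq ST finset.subsetT.
  by rewrite cardsT card_ord.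
rewrite finset.setCT (size0nil (s := [seq x i | i in finset.set0])); last first.
  by rewrite size_map -cardE cards0.
suff -> : [seq x i | i in finset.setTfor 'I_(size s)] = s by [].
rewrite /image_mem enum_setT -enumT /x.
by rewrite -[RHS](mkseq_nth 0 s) /mkseq -val_enum_ord -map_comp.
Qed.

(* Either some cocycle [y] is nonzero, and then [y = l (h1 y)] forces
   [1 <= a * alpha], or all brackets vanish. *)
Lemma radius_dichotomy : 1 <= a * alpha \/ forall s, l s = 0.
Proof.
have [[y [y0 ly]]|H] := pselect (exists y, y != 0 /\ l' y [::] = 0); last first.
  right; apply: Linf_trivial => y ly; apply/eqP/negPn/negP => y0.
  by apply: H; exists y.
left; have yE : l [:: h1 y] = y by have := hP y; rewrite ly linear0 addr0.
have N0 : (0 < N)%N.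
  rewrite lt0n; apply: contraNneq y0 => N0; rewrite -yE lN//.
  by rewrite N0.
have y1 := is_norm_gt0 n1P y0.
have : nrm1 y <= lam 1 * (a * nrm1 y).
  have := nrm1_scaled_le n0P n1P lP [:: h1 y].
  rewrite /= invr1 scale1r yE big_seq1 => /le_trans; apply.
  by rewrite ler_wpM2l//; case: (opnorm_h1P h1 n0P n1P).
rewrite mulrA -{1}[nrm1 y]mul1r ler_pM2r// => /le_trans; apply.
rewrite mulrC ler_wpM2l// /alpha_l big_ltn// lerDl sumr_ge0// => i _.
exact: lam0.
Qed.

(** The derivative at [g] of the scalar majorant of [h1] composed with [nonlin] is at most [1/2];
    this makes that map a contraction on the ball of radius [g]. *)
Definition contracting (g : R) : Prop :=
  a * \sum_(2 <= i < N.+1) lam i * (i%:R * g ^+ i.-1) <= 2^-1.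

Lemma exists_radius v : nrm0 v * (12 * a * alpha) < 1 ->
  exists g, [/\ 0 <= g, contracting g &
     2 * nrm0 v + a * \sum_(2 <= i < N.+1) lam i * g ^+ i <= g].
Proof.
move=> vB; have [X1|l0] := radius_dichotomy; last first.
  have lz i : lam i = 0.
    suff -> : bracket_norm l nrm0 nrm1 i = 0 / i`!%:R by rewrite mul0r.
    congr (_ / _); apply/eqP; rewrite eq_le; apply/andP; split.
      apply: ge_sup => [|_ [s _ <-]]; last by rewrite l0 (is_norm0 n1P).
      exists (nrm1 (l (nseq i 0))), (nseq i 0) => //; rewrite /= size_nseq; split => // x.
      by case/nseqP => -> _; rewrite (is_norm0 n0P).
    by case: (opnorm_lP n0P n1P lP).
  (* Without nonlinear terms the majorant inequality is an equality for this [g]. *)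
  exists (2 * nrm0 v); split.
  - by rewrite mulr_ge0// (is_norm_ge0 n0P).
  - by rewrite /contracting big1 ?mulr0 ?invr_ge0// => i _; rewrite lz mul0r.
  - by rewrite big1 ?mulr0 ?addr0// => i _; rewrite lz mul0r.
have [X XE] : exists X, X = a * alpha by exists (a * alpha).
(* This [g] gives [X * g = 1/4], and [1 <= X] gives [g <= 1/4], which controls the higher powers of
   [g]. *)
rewrite -XE in X1; pose g := (4 * X)^-1.
have X0 : 0 < X by exact: lt_le_trans X1.
have g0 : 0 < g by rewrite invr_gt0 mulr_gt0.
have g4 : g <= 4^-1.
  by rewrite /g lef_pV2 ?posrE ?mulr_gt0// ler_peMr.
have Xg : X * g = 4^-1 by rewrite /g invfM mulrCA mulfV ?mulr1// gt_eqF.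
have lam_alpha : \sum_(2 <= i < N.+1) lam i <= alpha.
  rewrite /alpha_l; have [->|N0] := posnP N; first by rewrite !big_geq.
  rewrite [leRHS]big_ltn// -[leLHS]add0r lerD//; first exact: lam0 1%N.
have sum_le (c : nat -> R) e : 0 <= e -> (forall i, (2 <= i)%N -> c i <= e) ->
    a * \sum_(2 <= i < N.+1) lam i * c i <= X * e.
  move=> e0 ce; rewrite XE -mulrA ler_wpM2l//.
  apply: (@le_trans _ _ ((\sum_(2 <= i < N.+1) lam i) * e)); last by rewrite ler_wpM2r.
  rewrite mulr_suml big_nat [leRHS]big_nat ler_sum// => i /andP[i2 _].
  by rewrite ler_wpM2l// ce.
(* Passing from [i] to [i + 1] multiplies the left side by [g * (i + 1) / i], which is at most 1 as
   [g <= 1/4]. *)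
have pw i : (2 <= i)%N -> i%:R * g ^+ i.-1 <= 2 * g.
  case: i => [//|[//|i]] _ /=.
  rewrite exprSr mulrA ler_wpM2r ?(ltW g0)//.
  elim: i => [|i IH]; first by rewrite expr0 mulr1.
  apply: le_trans IH; rewrite exprSr mulrCA [leRHS]mulrC ler_wpM2l ?exprn_ge0 ?(ltW g0)//.
  have i0 : 0 <= i%:R :> R by [].
  have gi : i%:R * g <= i%:R * 4^-1 by rewrite ler_wpM2l.
  by rewrite -[i.+3]addn3 -[i.+2]addn2 !natrD; lra.
exists g; split; first exact: ltW.
- rewrite /contracting; apply: (le_trans (sum_le _ (2 * g) _ pw)).
    by rewrite mulr_ge0// ltW.
  by rewrite mulrCA Xg; lra.
- have S2 := sum_le (fun i => g ^+ i) (g * g) (mulr_ge0 (ltW g0) (ltW g0)).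
  have H : a * \sum_(2 <= i < N.+1) lam i * g ^+ i <= X * (g * g).
    apply: S2 => i i2; rewrite -expr2 ler_wiXn2l// ?(ltW g0)//.
    by rewrite (le_trans g4)// invf_le1// ler1n.
  rewrite mulrA Xg in H.
  have vX : 12 * (nrm0 v * X) < 1 by rewrite XE; move: vB; congr (_ < _); ring.
  (* The constant 12 of the ball enters here: [1 / (12 X) = g / 3], and [2/3 + 1/4 <= 1] closes the
     majorant inequality. *)
  have vg : nrm0 v <= g / 3.
    by rewrite -(ler_pM2r X0) mulrAC (mulrC g) Xg; lra.
  lra.
Qed.

End Radius.

(** * The divided difference of Phi and smoothness of Psi *)

Section DividedDifference.
Variables (R : realType) (n m1 N : nat) (l : seq 'rV[R]_n -> 'rV[R]_m1).
Variables (h1 : {linear 'rV[R]_m1 -> 'rV[R]_n}).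
Variables (nrm0 : 'rV[R]_n -> R) (nrm1 : 'rV[R]_m1 -> R).
Hypotheses (lP : multilin0 l) (n0P : is_norm nrm0) (n1P : is_norm nrm1).
Local Notation a := (opnorm_h1 nrm0 nrm1 h1).
Local Notation lam := (bracket_norm l nrm0 nrm1).
Local Notation F := (nonlin N l).
Local Notation contracting := (contracting N l h1 nrm0 nrm1).

(** Passes from [(x, ..., x)] to [(y, ..., y)] one slot at a time, with [u] in the slot being
    changed. For [x = y] it is the differential of [Phi] in the direction [u]. *)
Definition divdiff x y u : 'rV[R]_n := u + h1 (\sum_(2 <= i < N.+1) (i`!%:R)^-1 *:
  \sum_(j < i) l (nseq j y ++ u :: nseq (i - j.+1) x)).

Lemma divdiffE x y : divdiff x y (y - x) = (y + h1 (F y)) - (x + h1 (F x)).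
Proof.
rewrite /divdiff opprD addrACA; congr (_ + _).
rewrite -linearB /nonlin -sumrB; congr (h1 _); apply: eq_bigr => i _.
rewrite -scalerBr; congr (_ *: _).
pose f j := l (nseq j y ++ nseq (i - j) x).
transitivity (\sum_(0 <= j < i) (f j.+1 - f j)); last first.
  by rewrite telescope_sumr// /f subnn subn0 cats0.
rewrite big_mkord; apply: eq_bigr => j _; rewrite /f.
have -> : (i - j = (i - j.+1).+1)%N by rewrite -subSn.
rewrite (multilin0D _ _ _ _ lP) -[- x]scaleN1r (multilin0Z _ _ _ _ lP) scaleN1r.
congr (l _ - l _); rewrite -cat_rcons; congr (_ ++ _).
by rewrite -cats1 -[[:: y]]/(nseq 1 y) -nseqD addn1.
Qed.

Lemma divdiff_linear x y : linear (divdiff x y).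
Proof.
move=> c u v; rewrite /divdiff scalerDr addrACA -linearZ -linearD; congr (_ + h1 _).
rewrite scaler_sumr -big_split; apply: eq_bigr => i _ /=.
rewrite scalerA mulrC -scalerA -scalerDr; congr (_ *: _).
by rewrite scaler_sumr -big_split; apply: eq_bigr => j _ /=; rewrite lP.
Qed.

(** Each of the [i] slots contributes at most [lam i * g ^+ i.-1 * nrm0 u], and [contracting] bounds
    the total. *)
Lemma divdiff_close g x y u : contracting g -> nrm0 x <= g -> nrm0 y <= g ->
  nrm0 (divdiff x y u - u) <= 2^-1 * nrm0 u.
Proof.
move=> cg xg yg; have g0 : 0 <= g := le_trans (is_norm_ge0 n0P x) xg.
rewrite /divdiff addrAC subrr add0r.
have [a0 h1a] := opnorm_h1P h1 n0P n1P.
apply: (le_trans (h1a _)).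
apply: (@le_trans _ _ (a * (\sum_(2 <= i < N.+1) lam i * (i%:R * g ^+ i.-1) * nrm0 u))).
  rewrite ler_wpM2l// (le_trans (is_norm_sum n1P _ _ _))// ler_sum// => i _.
  rewrite scaler_sumr (le_trans (is_norm_sum n1P _ _ _))//.
  rewrite (_ : _ * _ * nrm0 u = \sum_(j < i) lam i * (g ^+ i.-1 * nrm0 u)); last first.
    by rewrite sumr_const card_ord -mulr_natl; ring.
  apply: ler_sum => j _.
  have sz : size (nseq j y ++ u :: nseq (i - j.+1) x) = i.
    by rewrite size_cat /= !size_nseq addnS -addSn subnKC.
  have := nrm1_scaled_le n0P n1P lP (nseq j y ++ u :: nseq (i - j.+1) x).
  rewrite sz => /le_trans; apply; rewrite ler_wpM2l ?bracket_norm_ge0//.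
  rewrite big_cat big_cons /= !big_nseq !iter_mulr_1.
  rewrite (_ : g ^+ i.-1 = g ^+ j * g ^+ (i - j.+1)); last first.
    rewrite -exprD; congr (_ ^+ _).
    move: (ltn_ord j); move: (nat_of_ord j) => q.
    by case: (i) => // i' qi; rewrite subSS subnKC.
  rewrite mulrCA [leRHS]mulrC ler_wpM2l ?(is_norm_ge0 n0P)//.
  rewrite ler_pM ?exprn_ge0 ?(is_norm_ge0 n0P)//.
    by rewrite lerXn2r// nnegrE (is_norm_ge0 n0P).
  by rewrite lerXn2r// nnegrE (is_norm_ge0 n0P).
by rewrite -mulr_suml mulrA ler_wpM2r// (is_norm_ge0 n0P).
Qed.

Lemma divdiff_lower g x y u : contracting g -> nrm0 x <= g -> nrm0 y <= g ->
  nrm0 u <= 2 * nrm0 (divdiff x y u).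
Proof.
move=> cg xg yg; have := divdiff_close u cg xg yg.
have := is_norm_leD n0P (divdiff x y u) (- (divdiff x y u - u)).
by rewrite (is_normN n0P) opprB addrC subrK; lra.
Qed.

Definition divdiff_mx x y : 'M[R]_n := lin1_mx (divdiff x y).

Lemma mul_divdiff_mx x y u : u *m divdiff_mx x y = divdiff x y u.
Proof.
pose D : {linear 'rV[R]_n -> 'rV[R]_n} :=
  HB.pack (divdiff x y) (GRing.isLinear.Build R _ _ _ (divdiff x y) (divdiff_linear x y)).
exact: (mul_rV_lin1 D).
Qed.

(** The lower bound makes the kernel trivial, which suffices for a square matrix. *)
Lemma divdiff_mx_unit g x y : contracting g -> nrm0 x <= g -> nrm0 y <= g ->
  divdiff_mx x y \in unitmx.
Proof.
move=> cg xg yg; rewrite -row_free_unit -kermx_eq0; apply/eqP/row_matrixP => i.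
rewrite row0; apply: (is_norm_eq0 n0P); apply/eqP.
rewrite eq_le (is_norm_ge0 n0P) andbT (le_trans (divdiff_lower _ cg xg yg))//.
by rewrite -mul_divdiff_mx -row_mul mulmx_ker row0 (is_norm0 n0P) mulr0.
Qed.

Lemma subalg_divdiff_mx (T : Type) (C : (T -> R) -> Prop) (f1 f2 : T -> 'rV[R]_n) i j :
  subalgebra C -> (forall b, C (fun t => f1 t 0 b)) -> (forall b, C (fun t => f2 t 0 b)) ->
  C (fun t => divdiff_mx (f1 t) (f2 t) i j).
Proof.
move=> CP C1 C2; under eq_fun do rewrite mxE /divdiff mxE.
apply: (subalgD CP); first exact: subalgC CP _.
apply: (subalg_linear CP) => b; under eq_fun do rewrite summxE.
apply: (subalg_sum CP) => k; under eq_fun do rewrite mxE summxE.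
apply: (subalgM CP); first exact: subalgC CP _.
apply: (subalg_sum CP) => p.
(* Three labels encode the mixed argument list, so that it becomes a [map] to which
   [subalg_multilin0] applies. *)
pose f (c : 'I_3) t := if c == 0 then f1 t else if c == 1 then f2 t else delta_mx 0 i.
have E t : nseq p (f2 t) ++ delta_mx 0 i :: nseq (k - p.+1) (f1 t) =
    [seq f c t | c <- nseq p 1 ++ 2%:R :: nseq (k - p.+1) 0].
  by rewrite map_cat /= !map_nseq.
under eq_fun do rewrite E.
apply: (subalg_multilin0 CP) => // c d; rewrite /f.
by case: eqP => // _; case: eqP => // _; exact: subalgC CP _.
Qed.

End DividedDifference.

Lemma cvg_rV (R : realType) m (T : Type) (F : set_system T) (FF : Filter F)
    (f : T -> 'rV[R]_m) (x : 'rV[R]_m) :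
  (forall j, (fun t => f t 0 j) @ F --> x 0 j) -> f @ F --> x.
Proof.
move=> fx; apply/cvgrPdist_le => e e0.
have H : \forall t \near F, forall j, `|x 0 j - f t 0 j| <= e.
  by apply: filter_forall => j; move/cvgrPdist_le : (fx j) => /(_ _ e0).
apply: filterS H => t H; apply: mx_norm_bound => [|i j]; first exact: ltW.
by rewrite (ord1 i) !mxE.
Qed.

Lemma subalgebra_continuous_at (R : realType) (T : topologicalType) (x : T) :
  subalgebra (fun f : T -> R => {for x, continuous f}).
Proof.
split=> [c|f g cf cg|f g cf cg].
- exact: cst_continuous.
- exact: continuousD.
- exact: continuousM.
Qed.

(** * Smoothness, immersion and continuity of the inverse *)

Section Smooth.
Variables (R : realType) (n m1 m2 N : nat).
Variables (l : seq 'rV[R]_n -> 'rV[R]_m1) (l' : 'rV[R]_m1 -> seq 'rV[R]_n -> 'rV[R]_m2).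
Variables (h1 : {linear 'rV[R]_m1 -> 'rV[R]_n}) (h2 : {linear 'rV[R]_m2 -> 'rV[R]_m1}).
Variables (nrm0 : 'rV[R]_n -> R) (nrm1 : 'rV[R]_m1 -> R).
Hypotheses (L : Linf_data N l l').
Hypothesis hP : forall y, l [:: h1 y] + h2 (l' y [::]) = y.
Hypotheses (n0P : is_norm nrm0) (n1P : is_norm nrm1).
Local Notation a := (opnorm_h1 nrm0 nrm1 h1).
Local Notation alpha := (alpha_l nrm0 nrm1 N l).
Local Notation F := (nonlin N l).
Local Notation contracting := (contracting N l h1 nrm0 nrm1).
Local Notation Psi := (Psi l h1).
Local Notation Q := (divdiff_mx N l h1).

Let lP := Linf_multilin L.
Let lN := Linf_strict L.

(** [Bset] without the cocycle condition: an open set of the whole space, so ordinary directional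
    derivatives and neighbourhoods are available around points of [Bset]. *)
Definition conv_dom : set 'rV[R]_n := [set v | nrm0 v * (12 * a * alpha) < 1].
Local Notation O := conv_dom.

Lemma open_conv_dom : open O.
Proof.
apply: (@open_comp _ _ (fun v => nrm0 v * (12 * a * alpha)) [set x | x < 1]); last exact: open_lt.
move=> v _; apply: (@continuousM R 'rV[R]_n nrm0 (cst (12 * a * alpha)) v).
  exact: is_norm_continuous.
exact: cst_continuous.
Qed.

Lemma near_conv_dom v : O v -> \forall x \near v, O x.
Proof. by move=> Ov; apply: open_nbhs_nbhs; split => //; exact: open_conv_dom. Qed.

Lemma PsiK v : O v -> Psi v + h1 (F (Psi v)) = v.
Proof.
by move=> /(exists_radius L hP n0P n1P)[g [g0 _ vg]]; exact: (Psi_fixpoint n0P n1P lP lN g0 vg).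
Qed.

(** The larger of the two radii bounds both points and is itself one of the contracting ones. *)
Lemma contracting_Psi2 v w : O v -> O w ->
  exists g, [/\ contracting g, nrm0 (Psi v) <= g & nrm0 (Psi w) <= g].
Proof.
move=> /(exists_radius L hP n0P n1P)[g [g0 cg vg]] /(exists_radius L hP n0P n1P)[k [k0 ck wk]].
have vg' := Psi_le n0P n1P lP lN g0 vg; have wk' := Psi_le n0P n1P lP lN k0 wk.
have [gk|/ltW kg] := leP g k.
  by exists k; split => //; exact: le_trans gk.
by exists g; split => //; exact: le_trans kg.
Qed.

Lemma divdiff_Psi v w : O v -> O w -> (Psi w - Psi v) *m Q (Psi v) (Psi w) = w - v.
Proof. by move=> Ov Ow; rewrite mul_divdiff_mx// divdiffE// !PsiK. Qed.

Lemma unit_divdiff_Psi v w : O v -> O w -> Q (Psi v) (Psi w) \in unitmx.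
Proof.
by move=> Ov Ow; have [g [cg vg wg]] := contracting_Psi2 Ov Ow; exact: (divdiff_mx_unit lP n0P n1P cg).
Qed.

Lemma Psi_lipschitz v w : O v -> O w -> nrm0 (Psi w - Psi v) <= 2 * nrm0 (w - v).
Proof.
move=> Ov Ow; have [g [cg vg wg]] := contracting_Psi2 Ov Ow.
by rewrite -(divdiff_Psi Ov Ow) mul_divdiff_mx// (divdiff_lower lP n0P n1P _ cg).
Qed.

Lemma Psi_continuous v : O v -> {for v, continuous Psi}.
Proof.
move=> Ov; have [C C0 xC] := is_norm_ge_mx n0P; have [D D0 nD] := is_norm_le_mx n0P.
apply/(@cvgrPdist_le _ _ _ (nbhs v) (nbhs_filter v)) => e e0.
have e1 : 0 < e / (2 * C * D) by rewrite divr_gt0// !mulr_gt0.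
have : \forall w \near v, `|v - w| < e / (2 * C * D).
  by apply/(@nbhs_normP _ _ v); exists (e / (2 * C * D)).
apply: filterS2 (near_conv_dom Ov) => w Ow /ltW vw.
rewrite (le_trans (xC _))// (le_trans (ler_wpM2l (ltW C0) (Psi_lipschitz Ow Ov)))//.
rewrite (le_trans (ler_wpM2l (ltW C0) (ler_wpM2l _ (nD _))))//.
rewrite (_ : C * (2 * (D * `|v - w|)) = `|v - w| * (2 * C * D)); last by ring.
by rewrite -ler_pdivlMr ?mulr_gt0.
Qed.

(** Cramer's formula for the inverse, chosen over [invmx] because it is visibly rational in the
    entries, without a case distinction. *)
Definition dPsi2 v w u : 'rV[R]_n :=
  u *m ((\det (Q (Psi v) (Psi w)))^-1 *: \adj (Q (Psi v) (Psi w))).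

Lemma dPsi2E v w u : O v -> O w -> dPsi2 v w u = u *m invmx (Q (Psi v) (Psi w)).
Proof. by move=> Ov Ow; rewrite /dPsi2 /invmx unit_divdiff_Psi. Qed.

Lemma dPsi2K v w u : O v -> O w -> dPsi2 v w u *m Q (Psi v) (Psi w) = u.
Proof. by move=> Ov Ow; rewrite dPsi2E// mulmxKV// unit_divdiff_Psi. Qed.

Lemma dPsi2_diff v w h : O v -> O w -> dPsi2 v w (h *: (w - v)) = h *: (Psi w - Psi v).
Proof.
by move=> Ov Ow; rewrite dPsi2E// -(divdiff_Psi Ov Ow) -scalemxAl mulmxK// unit_divdiff_Psi.
Qed.

Lemma subalg_dPsi2 (T : Type) (C : (T -> R) -> Prop) (f1 f2 : T -> 'rV[R]_n) u j :
  subalgebra C -> (forall b, C (fun t => Psi (f1 t) 0 b)) ->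
  (forall b, C (fun t => Psi (f2 t) 0 b)) ->
  C (fun t => (\det (Q (Psi (f1 t)) (Psi (f2 t))))^-1) ->
  C (fun t => dPsi2 (f1 t) (f2 t) u 0 j).
Proof.
move=> CP C1 C2 Cd; under eq_fun do rewrite mxE.
apply: (subalg_sum CP) => i; under eq_fun do rewrite mxE.
apply: (subalgM CP); first exact: subalgC CP _.
apply: (subalgM CP) => //; apply: (subalg_adj CP) => p q.
exact: (subalg_divdiff_mx N h1 lP p q CP C1 C2).
Qed.

(** By [dPsi2_diff] the difference quotient equals [G h] for small [h != 0], and [G] is continuous
    at 0. *)
Lemma is_derive_Psi (v u : 'rV[R]_n) j : O v ->
  is_derive v u (fun x => Psi x 0 j) (dPsi2 v v u 0 j).
Proof.
move=> Ov; pose G (h : R) := dPsi2 v (h *: u + v) u 0 j.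
pose line (h : R) := h *: u + v.
have line0 : line 0 = v by rewrite /line scale0r add0r.
have cline : {for 0, continuous line}.
  by apply: continuousD; [exact: scalel_continuous|exact: cst_continuous].
have cG : {for 0, continuous G}.
  have CP := @subalgebra_continuous_at R R 0.
  have C1 b : {for (0 : R), continuous (fun=> Psi v 0 b)} by exact: cst_continuous.
  have C2 b : {for (0 : R), continuous (fun h => Psi (line h) 0 b)}.
    apply: (@continuous_comp _ _ _ line (fun x => Psi x 0 b)) => //.
    apply: (@continuous_comp _ _ _ Psi (fun x : 'rV[R]_n => x 0 b)); last exact: coord_continuous.
    by rewrite line0; exact: Psi_continuous.
  apply: (subalg_dPsi2 (f1 := fun=> v) (f2 := line) u j CP C1 C2).
  apply: continuousV.
    by rewrite line0 -unitfE -unitmxE unit_divdiff_Psi.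
  apply: (subalg_det CP) => p q.
  exact: (subalg_divdiff_mx N h1 lP p q CP C1 C2).
have dG : (fun h => h^-1 *: (((fun x => Psi x 0 j) \o shift v) (h *: u) - Psi v 0 j))
    @ 0^' --> dPsi2 v v u 0 j.
  have G0 : G 0 = dPsi2 v v u 0 j by rewrite /G -/(line 0) line0.
  have cG' : G @ 0^' --> G 0 by exact: (continuous_withinNx G 0).1.
  rewrite -G0; apply: cvg_trans cG'; apply: near_eq_cvg.
  have nO : \forall h \near (0 : R), O (line h).
    by apply: cline; rewrite line0; exact: near_conv_dom.
  near=> h.
  have Oh : O (line h) by near: h; exact: nbhs_dnbhs nO.
  have h0 : h != 0 by near: h; exact: nbhs_dnbhs_neq.
  have uE : h^-1 *: (line h - v) = u.
    by rewrite /line -addrA subrr addr0 scalerA mulVf ?scale1r.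
  have := congr1 (fun x : 'rV[R]_n => x 0 j) (dPsi2_diff h^-1 Ov Oh).
  by rewrite uE => E; apply: (etrans E); rewrite !mxE.
apply: DeriveDef; first by apply/cvg_ex; exists (dPsi2 v v u 0 j).
exact: cvg_lim dG.
Unshelve. all: by end_near. Qed.

(* The algebra generated by the coordinates of [Psi], closed under inverting
   functions without zeros; it is stable under directional derivatives. *)
Inductive psi_alg : ('rV[R]_n -> R) -> Prop :=
| PsiAlgC c : psi_alg (fun=> c)
| PsiAlgX j : psi_alg (fun v => Psi v 0 j)
| PsiAlgD f g : psi_alg f -> psi_alg g -> psi_alg (fun v => f v + g v)
| PsiAlgM f g : psi_alg f -> psi_alg g -> psi_alg (fun v => f v * g v)
| PsiAlgV f : psi_alg f -> (forall v, O v -> f v != 0) -> psi_alg (fun v => (f v)^-1).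

Lemma psi_alg_subalgebra : subalgebra psi_alg.
Proof. by split; [exact: PsiAlgC|exact: PsiAlgD|exact: PsiAlgM]. Qed.

Lemma psi_alg_dPsi u j : psi_alg (fun v => dPsi2 v v u 0 j).
Proof.
apply: (subalg_dPsi2 (f1 := id) (f2 := id) u j psi_alg_subalgebra PsiAlgX PsiAlgX).
apply: PsiAlgV => [|v Ov]; last by rewrite -unitfE -unitmxE unit_divdiff_Psi.
apply: (subalg_det psi_alg_subalgebra) => p q.
exact: (subalg_divdiff_mx N h1 lP p q psi_alg_subalgebra PsiAlgX PsiAlgX).
Qed.

Lemma psi_alg_continuous f : psi_alg f -> forall v, O v -> {for v, continuous f}.
Proof.
elim=> [c|j|{}f g _ cf _ cg|{}f g _ cf _ cg|{}f _ cf f0] v Ov.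
- exact: cst_continuous.
- apply: (@continuous_comp _ _ _ Psi (fun x : 'rV[R]_n => x 0 j)).
    exact: Psi_continuous.
  exact: coord_continuous.
- by apply: continuousD; [exact: cf|exact: cg].
- by apply: continuousM; [exact: cf|exact: cg].
- by apply: continuousV; [exact: f0|exact: cf].
Qed.

Lemma psi_alg_derive f u : psi_alg f ->
  exists2 df, psi_alg df & forall v, O v -> is_derive v u f (df v).
Proof.
elim=> [c|j|{}f g _ [df Cdf fE] _ [dg Cdg gE]|{}f g Cf [df Cdf fE] Cg [dg Cdg gE]|{}f Cf [df Cdf fE] f0].
- by exists (fun=> 0); [exact: PsiAlgC|move=> v _; exact: is_derive_cst].
- exists (fun v => dPsi2 v v u 0 j); first exact: psi_alg_dPsi.
  by move=> v; exact: is_derive_Psi.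
- exists (fun v => df v + dg v); first exact: PsiAlgD.
  by move=> v Ov; exact: is_deriveD (fE _ Ov) (gE _ Ov).
- exists (fun v => f v * dg v + g v * df v).
    by apply: PsiAlgD; apply: PsiAlgM.
  by move=> v Ov; exact: is_deriveM (fE _ Ov) (gE _ Ov).
(* The quotient rule, spelled with the generators of [psi_alg]. *)
- exists (fun v => -1 * ((f v)^-1 * (f v)^-1) * df v).
    apply: PsiAlgM => //; apply: PsiAlgM; first exact: PsiAlgC.
    by apply: PsiAlgM; apply: PsiAlgV.
  move=> v Ov; have [dfv fvE] := fE _ Ov; have fv0 := f0 _ Ov.
  apply: DeriveDef; first exact: derivableV.
  by rewrite deriveV// fvE mulN1r -invfM -expr2.
Qed.

Lemma psi_alg_row_derive (f : 'rV[R]_n -> 'rV[R]_n) u :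
  (forall j, psi_alg (fun v => f v 0 j)) ->
  exists2 df : 'rV[R]_n -> 'rV[R]_n, (forall j, psi_alg (fun v => df v 0 j)) &
    forall v, O v -> is_derive v u f (df v).
Proof.
move=> Cf; have /choice[df dfP] : forall j, exists df, psi_alg df /\
    forall v, O v -> is_derive v u (fun v => f v 0 j) (df v).
  by move=> j; have [df ? ?] := psi_alg_derive u (Cf j); exists df.
exists (fun v => \row_j df j v).
  by move=> j; under eq_fun do rewrite mxE; case: (dfP j).
move=> v Ov; have dv : derivable f v u.
  apply/derivable_mxP => i j; rewrite (ord1 i).
  by have [_ /(_ _ Ov)[]] := dfP j.
apply: DeriveDef => //; rewrite derive_mx//; apply/matrixP => i j; rewrite !mxE (ord1 i).
by have [_ /(_ _ Ov)[]] := dfP j.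
Qed.

(** Agreement on the open set [O] is enough to iterate, since a directional derivative depends only
    on the germ at the point. *)
Lemma iterD_psi_alg us : exists2 f : 'rV[R]_n -> 'rV[R]_n,
  (forall j, psi_alg (fun v => f v 0 j)) & forall v, O v -> Defs.iterD us Psi v = f v.
Proof.
elim: us => [|u us [f Cf fE]] /=; first by exists Psi => // j; exact: PsiAlgX.
have [df Cdf dfE] := psi_alg_row_derive u Cf.
exists df => // v Ov; have [_ <-] := dfE _ Ov; apply: near_eq_derive.
exact: filterS fE (near_conv_dom Ov).
Qed.

Lemma smooth_along_Psi (K : pred 'rV[R]_n) (A : set 'rV[R]_n) :
  A `<=` O -> smooth_along K A Psi.
Proof.
move=> AO us _; have [f Cf fE] := iterD_psi_alg us.
have nE v : O v -> \forall x \near v, f x = Defs.iterD us Psi x.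
  by move=> Ov; apply: filterS (near_conv_dom Ov) => x /fE.
split=> [v u Av _|].
  have [df _ dfE] := psi_alg_row_derive u Cf.
  apply: (near_eq_derivable (nE _ (AO _ Av))).
  by have [] := dfE _ (AO _ Av).
apply: continuous_in_subspaceT => v; rewrite inE => /AO Ov.
rewrite /continuous_at fE//.
apply: cvg_trans; first exact: (near_eq_cvg (nE _ Ov)).
by apply: cvg_rV => j; exact: (psi_alg_continuous (Cf j) Ov).
Qed.

Lemma derive_Psi_inj v u : O v -> 'D_u Psi v = 0 -> u = 0.
Proof.
move=> Ov; have dv : derivable Psi v u.
  by apply/derivable_mxP => i j; rewrite (ord1 i); have [] := is_derive_Psi u j Ov.
have -> : 'D_u Psi v = dPsi2 v v u.
  rewrite derive_mx//; apply/matrixP => i j; rewrite mxE (ord1 i).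
  by have [] := is_derive_Psi u j Ov.
by move=> du; rewrite -(dPsi2K u Ov Ov) du mul0mx.
Qed.

Lemma Psi_inj v w : O v -> O w -> Psi v = Psi w -> v = w.
Proof. by move=> Ov Ow vw; rewrite -(PsiK Ov) vw PsiK. Qed.

(** The inverse is the restriction of the polynomial map [Phi], which is continuous everywhere. *)
Lemma Psi_inverse_continuous v e : O v -> 0 < e ->
  exists2 d, 0 < d & forall w, O w -> `|Psi w - Psi v| < d -> `|w - v| < e.
Proof.
move=> Ov e0; pose Phi x := x + h1 (F x).
have cPhi : {for Psi v, continuous Phi}.
  apply: (@cvg_rV _ _ _ (nbhs (Psi v)) (nbhs_filter (Psi v))) => j.
  have CP := subalgebra_continuous R 'rV[R]_n.
  have cid b : continuous (fun x : 'rV[R]_n => x 0 b) by exact: coord_continuous.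
  suff : continuous (fun x => Phi x 0 j) by exact.
  have -> : (fun x => Phi x 0 j) = (fun x => x 0 j + h1 (F x) 0 j).
    by apply/funext => x; rewrite mxE.
  apply: (subalgD CP) => //; apply: (subalg_linear CP) => b.
  exact: (@subalg_nonlin _ _ _ N l lP _ _ (fun x => x) b CP cid).
have /cvgrPdist_lt/(_ _ e0) := cPhi.
move=> /(@nbhs_normP _ _ (Psi v))[d d0 dP]; exists d => // w Ow wv.
have := dP (Psi w); rewrite /= distrC => /(_ wv).
by rewrite /Phi !PsiK// distrC.
Qed.

End Smooth.

Unset Implicit Arguments.

Theorem theorem5p18 (R : realType) (n m1 m2 N : nat)
  (l : seq 'rV[R]_n -> 'rV[R]_m1) (l' : 'rV[R]_m1 -> seq 'rV[R]_n -> 'rV[R]_m2)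
  (h1 : {linear 'rV[R]_m1 -> 'rV[R]_n}) (h2 : {linear 'rV[R]_m2 -> 'rV[R]_m1})
  (nrm0 : 'rV[R]_n -> R) (nrm1 : 'rV[R]_m1 -> R) :
  Linf_data N l l' -> H1_zero l l' ->
  (forall y : 'rV[R]_m1, l [:: h1 y] + h2 (l' y [::]) = y) ->
  is_norm nrm0 -> is_norm nrm1 ->
  let B := Bset nrm0 nrm1 N l h1 in
  (forall v, B v -> MC N l (Psi l h1 v) = 0) /\
  smooth_along (kerl1 l) B (Psi l h1) /\
  exists U : set 'rV[R]_n,
    [/\ open_in_sub (kerl1 l) U, U `<=` B, U 0 & embedding_on (kerl1 l) U (Psi l h1)].
Proof.
move=> L _ hP n0P n1P B.
have BO : B `<=` conv_dom N l h1 nrm0 nrm1 by move=> v [].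
have B0 : B 0.
  split; last by rewrite (is_norm0 n0P) mul0r ltr01.
  by rewrite /kerl1 (multilin0_zero [::] [::] (Linf_multilin L)).
have smoothB := smooth_along_Psi L hP n0P n1P (K := kerl1 l) BO.
split.
  move=> v [/eqP lv vB]; have [g [g0 _ vg]] := exists_radius L hP n0P n1P vB.
  exact: (MC_Psi L hP n0P n1P g0 vg lv).
(* [B] is relatively open, being the trace of [conv_dom] on the kernel. *)
split=> //; exists B; split=> //.
  exists (conv_dom N l h1 nrm0 nrm1); split; first exact: open_conv_dom.
  by apply/seteqP; split=> x [].
split=> //.
- by move=> x u /BO Ox _; exact: (derive_Psi_inj L hP n0P n1P).
- by move=> x y /BO Ox /BO Oy; exact: (Psi_inj L hP n0P n1P).
- move=> x e /BO Ox e0.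
  have [d d0 dP] := Psi_inverse_continuous L hP n0P n1P Ox e0.
  by exists d => // y /BO; exact: dP.
Qed.
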